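(* Let $n\ge2$. There is a one-to-one correspondence between skeletal $n$-term $A_\infty$-conformal algebras and tuples $(A,M,\Theta)$ in which $A$ is an associative conformal algebra, $M$ is a conformal $A$-bimodule and $\Theta\in Z^{n+1}(A,M)$ is an $(n+1)$-cocycle of the associative conformal algebra $A$ with coefficients in the conformal $A$-bimodule $M$ (the correspondence being $A=\mathcal{A}_0$ and $M=\mathcal{A}_{n-1}$, with $\lambda$-multiplication and left and right $\lambda$-actions given by $\mu_2$, and $\Theta=\mu_{n+1}$). Further, this extends to a one-to-one correspondence between the equivalence classes of skeletal $n$-term $A_\infty$-conformal algebras and tuples $(A,M,[\Theta])$, where $[\Theta]\in H^{n+1}(A,M)$.
   Context: All vector spaces, linear maps and tensor products are over $\mathbb{C}$. For (graded) $\mathbb{C}[\partial]$-modules, a $\mathbb{C}$-linear map $\varphi$ from a $k$-fold tensor product to $M[\lambda_1,\ldots,\lambda_{k-1}]$ is conformal sesquilinear if $\varphi_{\lambda_1,\ldots,\lambda_{k-1}}(a_1,\ldots,\partial a_i,\ldots,a_k)=-\lambda_i\varphi_{\lambda_1,\ldots,\lambda_{k-1}}(a_1,\ldots,a_k)$ for $i\le k-1$ and $\varphi_{\lambda_1,\ldots,\lambda_{k-1}}(a_1,\ldots,a_{k-1},\partial a_k)=(\partial+\lambda_1+\cdots+\lambda_{k-1})\varphi_{\lambda_1,\ldots,\lambda_{k-1}}(a_1,\ldots,a_k)$. An associative conformal algebra is a $\mathbb{C}[\partial]$-module $A$ with a conformal sesquilinear map $A\otimes A\to A[\lambda]$, $a\otimes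 b\mapsto a_\lambda b$, with $a_\lambda(b_\mu c)=(a_\lambda b)_{\lambda+\mu}c$. A conformal $A$-bimodule is a $\mathbb{C}[\partial]$-module $M$ with conformal sesquilinear maps $A\otimes M\to M[\lambda]$, $a\otimes m\mapsto a_\lambda m$, and $M\otimes A\to M[\lambda]$, $m\otimes a\mapsto m_\lambda a$, such that $a_\lambda(b_\mu m)=(a_\lambda b)_{\lambda+\mu}m$, $a_\lambda(m_\mu b)=(a_\lambda m)_{\lambda+\mu}b$, $m_\lambda(a_\mu b)=(m_\lambda a)_{\lambda+\mu}b$. Hochschild complex: for $k\ge1$, $C^k(A,M)$ is the space of conformal sesquilinear maps $A^{\otimes k}\to M[\lambda_1,\ldots,\lambda_{k-1}]$, and $$(\delta\varphi)_{\lambda_1,\ldots,\lambda_k}(a_1,\ldots,a_{k+1})={a_1}_{\lambda_1}\varphi_{\lambda_2,\ldots,\lambda_k}(a_2,\ldots,a_{k+1})+\sum_{i=1}^k(-1)^i\varphi_{\lambda_1,\ldots,\lambda_{i-1},\lambda_i+\lambda_{i+1},\lambda_{i+2},\ldots,\lambda_k}(a_1,\ldots,{a_i}_{\lambda_i}a_{i+1},\ldots,a_{k+1})+(-1)^{k+1}\big(\varphi_{\lambda_1,\ldots,\lambda_{k-1}}(a_1,\ldots,a_k)\big)_{\lambda_1+\cdots+\lambda_k}a_{k+1}$$ (for $i=k$ the subscripts of $\varphi$ are $\lambda_1,\ldots,\lambda_{k-1}$). $Z^{k}(A,M)=\ker(\delta|_{C^{k}})$ and, for $k\ge2$, $H^{k}(A,M)=Z^{k}(A,M)/\delta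 C^{k-1}(A,M)$. An $A_\infty$-conformal algebra is a graded $\mathbb{C}[\partial]$-module $\mathcal{A}=\oplus_{i\in\mathbb{Z}}\mathcal{A}_i$ with conformal sesquilinear maps $\mu_k:\mathcal{A}^{\otimes k}\to\mathcal{A}[\lambda_1,\ldots,\lambda_{k-1}]$ of degree $k-2$, $k\ge1$, such that for all $N\ge1$ and homogeneous $a_1,\ldots,a_N$, $$\sum_{k+l=N+1}\sum_{i=1}^k(-1)^{i(l+1)+l(|a_1|+\cdots+|a_{i-1}|)}(\mu_k)_{\lambda_1,\ldots,\lambda_{i-1},\lambda_i+\cdots+\lambda_{i+l-1},\lambda_{i+l},\ldots,\lambda_{N-1}}\big(a_1,\ldots,a_{i-1},(\mu_l)_{\lambda_i,\ldots,\lambda_{i+l-2}}(a_i,\ldots,a_{i+l-1}),a_{i+l},\ldots,a_N\big)=0,$$ where for $i=k$ the subscripts of $\mu_k$ are just $\lambda_1,\ldots,\lambda_{k-1}$. It is $n$-term if $\mathcal{A}=\mathcal{A}_0\oplus\cdots\oplus\mathcal{A}_{n-1}$. An $n$-term $A_\infty$-conformal algebra is skeletal if only $\mathcal{A}_0$ and $\mathcal{A}_{n-1}$ may be nonzero and $\mu_1=0$; then for degree reasons only $\mu_2$ and $\mu_{n+1}$ can be nonzero (with $\mu_{n+1}$ supported on $\mathcal{A}_0^{\otimes(n+1)}$ with values in $\mathcal{A}_{n-1}$). In that case $\mathcal{A}_0$ is an associative conformal algebra via $a_\lambda b:=(\mu_2)_\lambda(a,b)$ and $\mathcal{A}_{n-1}$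 is a conformal $\mathcal{A}_0$-bimodule via $a_\lambda m:=(\mu_2)_\lambda(a,m)$, $m_\lambda a:=(\mu_2)_\lambda(m,a)$. Two skeletal $n$-term $A_\infty$-conformal algebras with structure maps $(\mu_2,\mu_{n+1})$ and $(\mu_2',\mu_{n+1}')$ on the same underlying graded $\mathbb{C}[\partial]$-module are equivalent if $\mu_2=\mu_2'$ and there is a conformal sesquilinear map $\sigma:\mathcal{A}_0^{\otimes n}\to\mathcal{A}_{n-1}[\lambda_1,\ldots,\lambda_{n-1}]$ with $\mu_{n+1}'=\mu_{n+1}+\delta\sigma$, $\delta$ being the Hochschild coboundary of $\mathcal{A}_0$ with coefficients in $\mathcal{A}_{n-1}$. *)

(* Defs.v *)
From HB Require Import structures.
From mathcomp Require Import all_boot all_order all_algebra.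
From mathcomp Require Import reals complex.
From mathcomp Require Import finmap monalg mpoly.

Set Implicit Arguments.
Unset Strict Implicit.
Unset Printing Implicit Defensive.

Import GRing.Theory.
Local Open Scope ring_scope.

(* A C[∂]-module is an [lmodType {poly C}]: ∂ acts as ['X *: _] and the scalar
   c as [c%:P *: _]. All indices are 0-based: arguments a_0, a_1, ... and
   variables λ_0, λ_1, ... *)

(* V[λ_0, ..., λ_(r-1)]: finitely supported families of elements of V indexed
   by monomials. *)
Notation pmod V r := {malg V['X_{1..r}]}.

Section PolynomialModules.
Context (C : fieldType).
Implicit Types V W : lmodType {poly C}.

(* λ_j in C[λ_0, ..., λ_(r-1)], and 0 when j >= r. *)
Definition lam r (j : nat) : mpoly r C := [tuple 'X_i | i < r]`_j.

Definition pmod_map V W r (g : V -> W) (q : pmod V r) : pmod W r :=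
  \sum_(m <- monalg.msupp q) << g (monalg.mcoeff m q) *g m >>.

(* f(λ) x *)
Definition ptens V r (f : mpoly r C) (x : V) : pmod V r :=
  \sum_(m <- mpoly.msupp f) << (mpoly.mcoeff m f)%:P *: x *g m >>.

(* f(λ) q(λ) *)
Definition pact V r (f : mpoly r C) (q : pmod V r) : pmod V r :=
  \sum_(m <- monalg.msupp q) ptens (f * 'X_[m]) (monalg.mcoeff m q).

(* q(t_0, ..., t_(r-1)) *)
Definition psubst V r s (t : nat -> mpoly s C) (q : pmod V r) : pmod V s :=
  \sum_(m <- monalg.msupp q)
    ptens (mmap1 (fun i : 'I_r => t i) m) (monalg.mcoeff m q).

(* F_(t_0, ..., t_(s-1)) (p(u_0, ..., u_(r-1))), where F is extended
   polynomially: for p = Σ_m λ^m p_m this is Σ_m u^m F_t(p_m). *)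
Definition plug V W r s N (u t : nat -> mpoly N C)
    (F : V -> pmod W s) (p : pmod V r) : pmod W N :=
  \sum_(m <- monalg.msupp p)
    pact (mmap1 (fun i : 'I_r => u i) m) (psubst t (F (monalg.mcoeff m p))).

Definition upd V k (a : k.-tuple V) (i : 'I_k) (x : V) : k.-tuple V :=
  [tuple if j == i then x else tnth a j | j < k].

(* Conformal sesquilinear maps V^{⊗k} -> W[λ_0, ..., λ_(k-2)], for k >= 1. *)
Record csesq V W k (F : k.-tuple V -> pmod W k.-1) : Prop := Csesq {
  csesq_linear : forall a (i : 'I_k) (c : C) x y,
    F (upd a i (c%:P *: x + y)) =
      pmod_map ( *:%R c%:P) (F (upd a i x)) + F (upd a i y);
  csesq_init : forall a (i : 'I_k) x, (i.+1 < k)%N ->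
    F (upd a i ('X *: x)) = - pact (lam _ i) (F (upd a i x));
  csesq_last : forall a (i : 'I_k) x, i.+1 = k ->
    F (upd a i ('X *: x)) =
      pmod_map ( *:%R 'X) (F (upd a i x))
        + pact (\sum_(j < k.-1) lam _ j) (F (upd a i x)) }.

(* Conformal sesquilinear maps U ⊗ V -> W[λ]; written a_λ b. *)
Record csesq2 (U V W : lmodType {poly C}) (f : U -> V -> pmod W 1) : Prop :=
  Csesq2 {
  csesq2_linearl : forall (c : C) a a' b,
    f (c%:P *: a + a') b = pmod_map ( *:%R c%:P) (f a b) + f a' b;
  csesq2_linearr : forall (c : C) a b b',
    f a (c%:P *: b + b') = pmod_map ( *:%R c%:P) (f a b) + f a b';
  csesq2_Dl : forall a b, f ('X *: a) b = - pact (lam _ 0) (f a b);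
  csesq2_Dr : forall a b,
    f a ('X *: b) = pmod_map ( *:%R 'X) (f a b) + pact (lam _ 0) (f a b) }.

(* With λ = λ_0 and μ = λ_1: a_λ q(μ) and (q(λ))_{λ+μ} b. *)
Definition lcomp (U V W : lmodType {poly C}) (f : U -> V -> pmod W 1)
    (a : U) (q : pmod V 1) : pmod W 2 :=
  plug (fun=> lam 2 1) (fun=> lam 2 0) (f a) q.

Definition rcomp (U V W : lmodType {poly C}) (f : U -> V -> pmod W 1)
    (q : pmod U 1) (b : V) : pmod W 2 :=
  plug (fun=> lam 2 0) (fun=> lam 2 0 + lam 2 1) (fun x => f x b) q.

Record assoc_conformal (A : lmodType {poly C}) := AssocConformal {
  ac_mul : A -> A -> pmod A 1;
  ac_sesq : csesq2 ac_mul;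
  ac_assoc : forall a b c,
    lcomp ac_mul a (ac_mul b c) = rcomp ac_mul (ac_mul a b) c }.

Record conformal_bimodule (A : lmodType {poly C}) (alg : assoc_conformal A)
    (M : lmodType {poly C}) := ConformalBimodule {
  cb_l : A -> M -> pmod M 1;
  cb_r : M -> A -> pmod M 1;
  cb_l_sesq : csesq2 cb_l;
  cb_r_sesq : csesq2 cb_r;
  cb_ll : forall a b m,
    lcomp cb_l a (cb_l b m) = rcomp cb_l (ac_mul alg a b) m;
  cb_lr : forall a m b,
    lcomp cb_l a (cb_r m b) = rcomp cb_r (cb_l a m) b;
  cb_rr : forall m a b,
    lcomp cb_r m (ac_mul alg a b) = rcomp cb_r (cb_r m a) b }.

(* For a = (a_0, ..., a_(N-1)) with N = k + l - 1 and a slot i < k, this is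
     F_{λ_0, ..., λ_(i-1), λ_i + ... + λ_(i+l-1), λ_(i+l), ..., λ_(N-2)}
       (a_0, ..., a_(i-1),
        H_{λ_i, ..., λ_(i+l-2)} (a_i, ..., a_(i+l-1)), a_(i+l), ..., a_(N-1)).
   For i = k - 1 the summed variable is not used. *)
Definition pcomp V W k l N (i : nat) (F : k.-tuple V -> pmod W k.-1)
    (H : l.-tuple V -> pmod V l.-1) (a : N.-tuple V) : pmod W N.-1 :=
  plug (fun j => lam _ (i + j)%N)
       (fun j => if (j < i)%N then lam _ j
                 else if j == i then \sum_(i <= t < i + l) lam _ t
                 else lam _ (j + l).-1)
       (fun x => F [tuple if (j < i)%N then a`_j
                          else if j == i :> nat then x
                          else a`_(j + l).-1 | j < k])
       (H [tuple a`_(i + j) | j < l]).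

Section Hochschild.
Context (A M : lmodType {poly C}) (mul : A -> A -> pmod A 1).
Context (lact : A -> M -> pmod M 1) (ract : M -> A -> pmod M 1).

(* The coboundary C^k -> C^(k+1), for k >= 1. The sign ε is applied as
   [_ *~ ε] with ε : int. *)
Definition delta k (phi : k.-tuple A -> pmod M k.-1)
    (a : k.+1.-tuple A) : pmod M k :=
  plug (fun j => lam _ j.+1) (fun=> lam _ 0) (lact a`_0)
       (phi [tuple a`_j.+1 | j < k])
  + \sum_(i < k)
      pcomp i phi (fun b : 2.-tuple A => mul b`_0 b`_1) a *~ (-1) ^+ i.+1
  + plug (fun j => lam _ j) (fun=> \sum_(t < k) lam _ t) (fun x => ract x a`_k)
         (phi [tuple a`_j | j < k]) *~ (-1) ^+ k.+1.

Definition cohomologous k (phi psi : k.+1.-tuple A -> pmod M k) : Prop :=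
  exists2 sigma : k.-tuple A -> pmod M k.-1,
    csesq sigma & forall a, psi a = phi a + delta sigma a.

End Hochschild.

Section Cohomology.
Context (A M : lmodType {poly C}) (alg : assoc_conformal A).
Context (bim : conformal_bimodule alg M).

(* Z^k(A, M) *)
Record cocycle k := Cocycle {
  cocycle_val :> k.-tuple A -> pmod M k.-1;
  cocycle_sesq : csesq cocycle_val;
  cocycle_eq0 : forall a,
    delta (ac_mul alg) (cb_l bim) (cb_r bim) cocycle_val a = 0 }.

Definition cohom_coset k (z : cocycle k.+1) : (k.+1.-tuple A -> pmod M k) -> Prop :=
  cohomologous (ac_mul alg) (cb_l bim) (cb_r bim) z.

(* H^(k+1)(A, M) for k >= 1: the set of cosets z + δ C^k(A, M). *)
Definition cohomology k := {X | exists z : cocycle k.+1, X = cohom_coset z}.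

Definition cohomology_class k (z : cocycle k.+1) : cohomology k :=
  exist _ (cohom_coset z) (ex_intro _ z erefl).

End Cohomology.

(* The structures making two C[∂]-modules A, M into a tuple (A, M, Θ) with
   Θ in Z^(n+1)(A, M), resp. into a tuple (A, M, [Θ]). *)
Record triple n (A M : lmodType {poly C}) := Triple {
  tr_alg : assoc_conformal A;
  tr_bim : conformal_bimodule tr_alg M;
  tr_theta : cocycle tr_bim n.+1 }.

Record triple_class n (A M : lmodType {poly C}) := TripleClass {
  tc_alg : assoc_conformal A;
  tc_bim : conformal_bimodule tc_alg M;
  tc_theta : cohomology tc_bim n }.

Definition class_of_triple n (A M : lmodType {poly C}) (T : triple n A M) :
    triple_class n A M :=
  TripleClass (cohomology_class (tr_theta T)).

(* A Z-graded C[∂]-module: a module with a direct sum decomposition, given by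
   its components and the canonical injections and projections. *)
Record graded_module := GradedModule {
  gr_tot :> lmodType {poly C};
  gr : int -> lmodType {poly C};
  gr_in : forall d, {linear gr d -> gr_tot};
  gr_pr : forall d, {linear gr_tot -> gr d};
  gr_inK : forall d, cancel (gr_in d) (gr_pr d);
  gr_pr_in : forall d e x, d != e -> gr_pr e (gr_in d x) = 0;
  gr_sum : forall x : gr_tot, exists2 s : seq int,
    uniq s & x = \sum_(d <- s) gr_in d (gr_pr d x) }.

Definition in_degree (G : graded_module) (d : int) (x : G) : Prop :=
  exists y, x = gr_in G d y.

(* [mu k] is μ_k for k >= 1; the unused [mu 0] is normalised to 0. *)
Record ainf_conformal (G : graded_module) := AinfConformal {
  mu :> forall k, k.-tuple G -> pmod G k.-1;
  mu_0 : forall a, @mu 0%N a = 0;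
  mu_sesq : forall k, (0 < k)%N -> csesq (@mu k);
  mu_degree : forall k (d : k.-tuple int) (a : k.-tuple G), (0 < k)%N ->
    (forall j, in_degree (tnth d j) (tnth a j)) ->
    forall m, in_degree (\sum_(j < k) tnth d j + k%:Z - 2)
                    (monalg.mcoeff m (@mu k a));
  mu_ainf : forall N (d : N.-tuple int) (a : N.-tuple G), (0 < N)%N ->
    (forall j, in_degree (tnth d j) (tnth a j)) ->
    \sum_(1 <= k < N.+1) \sum_(i < k)
      (let l := (N.+1 - k)%N in
       pcomp i (@mu k) (@mu l) a
         *~ (-1) ^ ((i.+1 * l.+1)%N%:Z + l%:Z * \sum_(j < i) d`_j)) = 0 }.

Definition n_term (n : nat) (G : graded_module) : Prop :=
  forall d, ~~ (0 <= d < n%:Z) -> forall x : gr G d, x = 0.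

Definition skeletal_support (n : nat) (G : graded_module) : Prop :=
  n_term n G /\
  forall d, d != 0 -> d != n.-1%:Z -> forall x : gr G d, x = 0.

Record skeletal (n : nat) (G : graded_module) := Skeletal {
  sk_ainf :> ainf_conformal G;
  sk_support : skeletal_support n G;
  sk_mu1 : forall a, sk_ainf 1%N a = 0 }.

Section Restriction.
Context (n : nat) (G : graded_module) (S : skeletal n G).

(* μ_2 on 𝒜_d ⊗ 𝒜_e, with values in 𝒜_f[λ]. *)
Definition mu2_at (d e f : int) (x : gr G d) (y : gr G e) : pmod (gr G f) 1 :=
  pmod_map (gr_pr G f) (S 2 [tuple gr_in G d x; gr_in G e y]).

Definition sk_mul : gr G 0 -> gr G 0 -> pmod (gr G 0) 1 := @mu2_at 0 0 0.

Definition sk_l : gr G 0 -> gr G n.-1%:Z -> pmod (gr G n.-1%:Z) 1 :=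
  @mu2_at 0 n.-1%:Z n.-1%:Z.

Definition sk_r : gr G n.-1%:Z -> gr G 0 -> pmod (gr G n.-1%:Z) 1 :=
  @mu2_at n.-1%:Z 0 n.-1%:Z.

Definition sk_top (a : n.+1.-tuple (gr G 0)) : pmod (gr G n.-1%:Z) n :=
  pmod_map (gr_pr G n.-1%:Z) (S n.+1 (map_tuple (gr_in G 0) a)).

End Restriction.

Definition sk_equiv n (G : graded_module) (S S' : skeletal n G) : Prop :=
  (forall a, S 2 a = S' 2 a) /\
  cohomologous (sk_mul S) (sk_l S) (sk_r S) (sk_top S) (sk_top S').

Definition skeletal_class n (G : graded_module) :=
  {X : skeletal n G -> Prop | exists S, X = sk_equiv S}.

Definition class_of_skeletal n (G : graded_module) (S : skeletal n G) :
    skeletal_class n G :=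
  exist _ (sk_equiv S) (ex_intro _ S erefl).

End PolynomialModules.

(* Main.v *)
Require Import Defs.
From HB Require Import structures.
From mathcomp Require Import all_boot all_order all_algebra.
From mathcomp Require Import zify.
From mathcomp Require Import boolp reals complex.
From mathcomp Require Import finmap monalg mpoly.

(* A degree count shows that a skeletal structure is determined by the
   restrictions of mu_2 to A_0 x A_0, A_0 x A_(n-1) and A_(n-1) x A_0 and of
   mu_(n+1) to A_0^(n+1): any other structure map of homogeneous elements would
   take values in a degree other than 0 and n - 1. Conversely, extend such
   restrictions by zero. In the A-infinity identities only the products
   mu_2 mu_2, mu_2 mu_(n+1) and mu_(n+1) mu_2 survive. Hence the identity is
   void unless N = 3, where it splits into associativity and the three bimodule
   axioms, or N = n + 2, where it is delta mu_(n+1) = 0. *)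

Set Implicit Arguments.
Unset Strict Implicit.
Unset Printing Implicit Defensive.

Import Order.TTheory GRing.Theory Num.Theory.
Local Open Scope ring_scope.

(** * Polynomials with coefficients in a module *)

Local Notation "p @_ m" := (monalg.mcoeff m p) : ring_scope.

(** The condition n > 1 keeps the cases apart: it separates the arities 2 and n + 1, the degrees 0
    and n - 1, and the identities N = 3 and N = n + 2. The composite of mu_(n+1) with itself
    vanishes because its values have degree n - 1 while it reads only components of degree 0. For N
    = n + 2 the signs agree with those of the coboundary up to even exponents; the one exception is
    a summand (n + 1)|a| in an exponent, with a the first argument, and the corresponding term is
    zero unless |a| = 0. Extension by zero is expressed through the projections onto the two
    components and not by cases on degrees, so glued maps are defined and composed on arbitrary
    elements. The carriers stay fixed: the bijections relate structures on one graded module to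
    structures on its components, and a separate construction realises every pair of modules as such
    components. *)

Lemma morphD0 (U V : zmodType) (f : U -> V) : {morph f : x y / x + y} -> f 0 = 0.
Proof. by move=> fD; apply: (@addrI _ (f 0)); rewrite -fD !addr0. Qed.

(* Sealed copies: a failed unification of two instances of the originals does
   not terminate in practice, because it unfolds them down to the finitely
   supported functions. *)
HB.lock Definition map_pm (C : fieldType) (V W : lmodType {poly C}) r
  (g : V -> W) (q : pmod V r) : pmod W r := pmod_map g q.
HB.lock Definition tens_pm (C : fieldType) (V : lmodType {poly C}) r
  (f : mpoly r C) (x : V) : pmod V r := ptens f x.
HB.lock Definition act_pm (C : fieldType) (V : lmodType {poly C}) r
  (f : mpoly r C) (q : pmod V r) : pmod V r := pact f q.
HB.lock Definition subst_pm (C : fieldType) (V : lmodType {poly C}) r s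
  (t : nat -> mpoly s C) (q : pmod V r) : pmod V s := psubst t q.
HB.lock Definition plug_pm (C : fieldType) (V W : lmodType {poly C}) r s N
  (u t : nat -> mpoly N C) (F : V -> pmod W s) (p : pmod V r) : pmod W N :=
  plug u t F p.

Section PolynomialModules.
Context (C : fieldType).
Implicit Types U V W : lmodType {poly C}.

(* [pmod_map], [pact], [psubst] and [plug] are all of this form. *)
Definition psum V (W : zmodType) r (phi : 'X_{1..r} -> V -> W) (q : pmod V r) : W :=
  \sum_(m <- monalg.msupp q) phi m q@_m.

Section Psum.
Context V (W : zmodType) r (phi : 'X_{1..r} -> V -> W).

(** Supports may shrink under sums and under maps of coefficients, so two such expressions are
    compared over a common larger index set. *)
Lemma psumEw (q : pmod V r) (d : {fset 'X_{1..r}}) :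
    (forall m, phi m 0 = 0) -> (monalg.msupp q `<=` d)%fset ->
  psum phi q = \sum_(m <- d) phi m q@_m.
Proof.
move=> phi0 sqd; apply: big_fset_incl sqd _ => m _ mNq.
by rewrite mcoeff_outdom ?phi0.
Qed.

Lemma psumD : (forall m, {morph phi m : x y / x + y}) ->
  {morph psum phi : p q / p + q}.
Proof.
move=> phiD p q.
have phi0 m : phi m 0 = 0 by exact: morphD0.
rewrite (psumEw phi0 (monalg.msuppD_le p q)) (psumEw phi0 (fsubsetUl _ (monalg.msupp q))).
rewrite (psumEw phi0 (fsubsetUr (monalg.msupp p) _)) -big_split /=.
by apply: eq_bigr => m _; rewrite monalg.mcoeffD phiD.
Qed.

End Psum.

Lemma pmod_mapL : @pmod_map C = @map_pm C. Proof. by rewrite unlock. Qed.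
Lemma pactL : @pact C = @act_pm C. Proof. by rewrite unlock. Qed.
Lemma plugL : @plug C = @plug_pm C. Proof. by rewrite unlock. Qed.

Lemma map_pmE V W r (g : V -> W) (q : pmod V r) m :
  g 0 = 0 -> (map_pm g q)@_m = g q@_m.
Proof.
move=> g0; rewrite unlock raddf_sum /=.
under eq_bigr do rewrite mcoeffU.
case: (boolP (m \in monalg.msupp q)) => [mq|mNq]; last first.
  rewrite mcoeff_outdom // g0 big_seq big1 // => i iq.
  by case: eqP iq mNq => // -> ->.
rewrite (big_fsetD1 m) //= eqxx big_seq big1 ?addr0 // => i.
by rewrite !inE => /andP[/negPf->].
Qed.

Lemma tens_pmE V r (f : mpoly r C) (x : V) m :
  (tens_pm f x)@_m = (mpoly.mcoeff m f)%:P *: x.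
Proof.
rewrite unlock /ptens raddf_sum /=.
under eq_bigr do rewrite mcoeffU.
case: (boolP (m \in mpoly.msupp f)) => [mf|mNf]; last first.
  rewrite mpoly.memN_msupp_eq0 // scale0r big_seq big1 // => i.
  by case: eqP mNf => // -> /negPf->.
rewrite (bigD1_seq m) ?mpoly.msupp_uniq //= eqxx big1 ?addr0 // => i.
by move=> /negPf->.
Qed.

Lemma act_pmE V r (f : mpoly r C) (q : pmod V r) :
  act_pm f q = psum (fun m => tens_pm (f * 'X_[m])) q.
Proof. by rewrite act_pm.unlock tens_pm.unlock. Qed.

Lemma subst_pmE V r s (t : nat -> mpoly s C) (q : pmod V r) :
  subst_pm t q = psum (fun m => tens_pm (mmap1 (fun i : 'I_r => t i) m)) q.
Proof. by rewrite subst_pm.unlock tens_pm.unlock. Qed.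

Lemma plug_pmE V W r s N (u t : nat -> mpoly N C) (F : V -> pmod W s) (p : pmod V r) :
  plug_pm u t F p =
  psum (fun m x => act_pm (mmap1 (fun i : 'I_r => u i) m) (subst_pm t (F x))) p.
Proof. by rewrite plug_pm.unlock act_pm.unlock subst_pm.unlock. Qed.

Lemma morphD_zmod (U' V' : zmodType) (f : U' -> V') :
  {morph f : x y / x + y} -> zmod_morphism f.
Proof.
by move=> fD x y; apply/(addIr (f y)); rewrite -fD !subrK.
Qed.

Lemma map_pm_additive V W r (g : {additive V -> W}) :
  zmod_morphism (@map_pm C V W r g).
Proof.
have g0 : g 0 = 0 by exact: raddf0.
move=> p q; apply/malgP => m; rewrite [RHS]monalg.mcoeffB !map_pmE //.
by rewrite monalg.mcoeffB; exact: raddfB.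
Qed.

HB.instance Definition _ V W r (g : {additive V -> W}) :=
  GRing.isZmodMorphism.Build (pmod V r) (pmod W r) (@map_pm C V W r g)
    (map_pm_additive g).

Lemma map_pm_comp U V W r (g : V -> W) (h : U -> V) (q : pmod U r) :
  g 0 = 0 -> h 0 = 0 -> map_pm g (map_pm h q) = map_pm (fun x => g (h x)) q.
Proof. by move=> g0 h0; apply/malgP => m; rewrite !map_pmE //= h0. Qed.

Lemma eq_map_pm V W r (g h : V -> W) (q : pmod V r) : g =1 h ->
  map_pm g q = map_pm h q.
Proof. by move=> /funext->. Qed.

Lemma map_pm_id V r (q : pmod V r) : map_pm id q = q.
Proof. by apply/malgP => m; rewrite map_pmE. Qed.

Lemma map_pm0 V W r (q : pmod V r) : map_pm (fun=> 0 : W) q = 0.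
Proof. by apply/malgP => m; rewrite map_pmE // monalg.mcoeff0. Qed.

Lemma tens_pm_additive V r (f : mpoly r C) : zmod_morphism (@tens_pm C V r f).
Proof.
by move=> x y; apply/malgP => m; rewrite [RHS]monalg.mcoeffB !tens_pmE scalerBr.
Qed.

HB.instance Definition _ V r (f : mpoly r C) :=
  GRing.isZmodMorphism.Build V (pmod V r) (@tens_pm C V r f) (tens_pm_additive f).

Lemma map_pm_tens V W r (g : {linear V -> W}) (f : mpoly r C) x :
  map_pm g (tens_pm f x) = tens_pm f (g x).
Proof.
have g0 : g 0 = 0 by exact: raddf0.
by apply/malgP => m; rewrite map_pmE // !tens_pmE linearZ.
Qed.

Lemma act_pm_additive V r (f : mpoly r C) : zmod_morphism (@act_pm C V r f).
Proof.
by apply/morphD_zmod => x y; rewrite !act_pmE; apply: psumD => m; exact: raddfD.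
Qed.

HB.instance Definition _ V r (f : mpoly r C) :=
  GRing.isZmodMorphism.Build (pmod V r) (pmod V r) (@act_pm C V r f)
    (act_pm_additive f).

Lemma subst_pm_additive V r s (t : nat -> mpoly s C) :
  zmod_morphism (@subst_pm C V r s t).
Proof.
by apply/morphD_zmod => x y; rewrite !subst_pmE; apply: psumD => m; exact: raddfD.
Qed.

HB.instance Definition _ V r s (t : nat -> mpoly s C) :=
  GRing.isZmodMorphism.Build (pmod V r) (pmod V s) (@subst_pm C V r s t)
    (subst_pm_additive t).

Lemma psum_map U V (W : zmodType) r (phi : 'X_{1..r} -> V -> W) (h : U -> V)
    (q : pmod U r) :
    (forall m, phi m 0 = 0) -> h 0 = 0 ->
  psum phi (map_pm h q) = psum (fun m x => phi m (h x)) q.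
Proof.
move=> phi0 h0; rewrite (@psumEw _ _ _ _ _ (monalg.msupp q)) //.
  by apply: eq_bigr => m _; rewrite map_pmE.
apply/fsubsetP => m; rewrite -!mcoeff_neq0 map_pmE //.
by apply: contra_neq => ->.
Qed.

Lemma map_pm_act V W r (g : {linear V -> W}) (f : mpoly r C) q :
  map_pm g (act_pm f q) = act_pm f (map_pm g q).
Proof.
rewrite !act_pmE psum_map => [|m|]; try exact: raddf0.
rewrite [in LHS]/psum raddf_sum; apply: eq_bigr => m _.
exact: map_pm_tens.
Qed.

Lemma map_pm_subst V W r s (g : {linear V -> W}) (t : nat -> mpoly s C)
    (q : pmod V r) :
  map_pm g (subst_pm t q) = subst_pm t (map_pm g q).
Proof.
rewrite !subst_pmE psum_map => [|m|]; try exact: raddf0.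
rewrite [in LHS]/psum raddf_sum; apply: eq_bigr => m _.
exact: map_pm_tens.
Qed.

Section Plug.
Context V W (r s N : nat) (u t : nat -> mpoly N C).
Implicit Types (F : V -> pmod W s) (p : pmod V r).

(** The substitutions are indexed by all of [nat], but only the first [r], resp. [s], values are
    read. The case distinctions in [pcomp] therefore have to match the formulas of [lcomp], [rcomp]
    and [delta] only in that range. *)
Lemma eq_plug (u' t' : nat -> mpoly N C) F F' p :
    (forall i, (i < r)%N -> u i = u' i) -> (forall i, (i < s)%N -> t i = t' i) ->
    F =1 F' -> plug_pm u t F p = plug_pm u' t' F' p.
Proof.
move=> uu' tt' FF'; rewrite !plug_pmE; apply: eq_bigr => m _; rewrite FF'.
congr act_pm; first by apply: eq_bigr => i _; rewrite uu'.
rewrite !subst_pmE; apply: eq_bigr => m' _; congr tens_pm.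
by apply: eq_bigr => i _; rewrite tt'.
Qed.

Lemma plugDr F p q : {morph F : x y / x + y} ->
  plug_pm u t F (p + q) = plug_pm u t F p + plug_pm u t F q.
Proof.
by move=> FD; rewrite !plug_pmE; apply: psumD => m x y; rewrite FD !raddfD.
Qed.

Lemma plug0r F : plug_pm u t F (0 : pmod V r) = 0.
Proof. by rewrite plug_pmE /psum monalg.msupp0 big_nil. Qed.

Lemma plugDl F F' p :
  plug_pm u t (fun x => F x + F' x) p = plug_pm u t F p + plug_pm u t F' p.
Proof.
by rewrite !plug_pmE /psum -big_split; apply: eq_bigr => m _; rewrite !raddfD.
Qed.

Lemma plug0l F p : (forall x, F x = 0) -> plug_pm u t F p = 0.
Proof.
by move=> F0; rewrite plug_pmE /psum big1 // => m _; rewrite F0 !raddf0.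
Qed.

End Plug.

(** Naturality in the inner module, and in [plug_map_l] in the outer one: these two rules carry the
    projections and injections of the graded module across a composition, which is how all
    composites of glued maps are computed. *)
Lemma plug_map_r U V W (r s N : nat) (u t : nat -> mpoly N C)
    (F : V -> pmod W s) (h : {additive U -> V}) (p : pmod U r) :
    {morph F : x y / x + y} ->
  plug_pm u t F (map_pm h p) = plug_pm u t (fun x => F (h x)) p.
Proof.
move=> FD; rewrite !plug_pmE psum_map //; last exact: raddf0.
by move=> m; rewrite (morphD0 FD) !raddf0.
Qed.

Lemma plug_map_l U V W (r s N : nat) (u t : nat -> mpoly N C)
    (F : U -> pmod V s) (h : {linear V -> W}) (p : pmod U r) :
  plug_pm u t (fun x => map_pm h (F x)) p = map_pm h (plug_pm u t F p).
Proof.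
rewrite !plug_pmE [in RHS]/psum raddf_sum; apply: eq_bigr => m _ /=.
by rewrite map_pm_act map_pm_subst.
Qed.

End PolynomialModules.

(** * Conformal sesquilinear maps *)

Section Sesquilinear.
Context (C : fieldType).
Implicit Types U V W : lmodType {poly C}.

Lemma map_pm_scale V W r (g : {linear V -> W}) (c : {poly C}) (q : pmod V r) :
  map_pm g (map_pm ( *:%R c) q) = map_pm ( *:%R c) (map_pm g q).
Proof.
rewrite !map_pm_comp ?raddf0 ?scaler0 //; apply: eq_map_pm => x.
by rewrite linearZ.
Qed.

(** The interface to sesquilinearity in terms of the sealed operations. *)
Lemma csesqP V W k (F : k.-tuple V -> pmod W k.-1) :
  csesq F <->
  [/\ forall a (i : 'I_k) (c : C) x y,
        F (upd a i (c%:P *: x + y)) =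
          map_pm ( *:%R c%:P) (F (upd a i x)) + F (upd a i y),
      forall a (i : 'I_k) x, (i.+1 < k)%N ->
        F (upd a i ('X *: x)) = - act_pm (lam _ _ i) (F (upd a i x))
    & forall a (i : 'I_k) x, i.+1 = k ->
        F (upd a i ('X *: x)) =
          map_pm ( *:%R 'X) (F (upd a i x))
            + act_pm (\sum_(j < k.-1) lam _ _ j) (F (upd a i x))].
Proof. by rewrite -pmod_mapL -pactL; split; case. Qed.

Lemma csesq2P U V W (f : U -> V -> pmod W 1) :
  csesq2 f <->
  [/\ forall (c : C) a a' b,
        f (c%:P *: a + a') b = map_pm ( *:%R c%:P) (f a b) + f a' b,
      forall (c : C) a b b',
        f a (c%:P *: b + b') = map_pm ( *:%R c%:P) (f a b) + f a b',
      forall a b, f ('X *: a) b = - act_pm (lam _ _ 0) (f a b)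
    & forall a b,
        f a ('X *: b) = map_pm ( *:%R 'X) (f a b) + act_pm (lam _ _ 0) (f a b)].
Proof. by rewrite -pmod_mapL -pactL; split; case. Qed.

Lemma map_pm_scale1 V r (q : pmod V r) : map_pm ( *:%R 1%:P) q = q.
Proof. by rewrite -[RHS]map_pm_id; apply: eq_map_pm => x; rewrite scale1r. Qed.

Lemma csesq_updD V W k (F : k.-tuple V -> pmod W k.-1) a i x y : csesq F ->
  F (upd a i (x + y)) = F (upd a i x) + F (upd a i y).
Proof.
case/csesqP => lin _ _; have := lin a i 1 x y.
by rewrite scale1r map_pm_scale1.
Qed.

Lemma csesq2Dl U V W (f : U -> V -> pmod W 1) b : csesq2 f ->
  {morph f^~ b : x y / x + y}.
Proof.
case/csesq2P => lin _ _ _ x y; have := lin 1 x y b.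
by rewrite scale1r map_pm_scale1.
Qed.

Lemma csesq2Dr U V W (f : U -> V -> pmod W 1) a : csesq2 f ->
  {morph f a : x y / x + y}.
Proof.
case/csesq2P => _ lin _ _ x y; have := lin 1 a x y.
by rewrite scale1r map_pm_scale1.
Qed.

Lemma csesq0 V W k : csesq (fun _ : k.-tuple V => 0 : pmod W k.-1).
Proof.
by apply/csesqP; split=> *; rewrite ?raddf0 ?oppr0 ?addr0.
Qed.

Lemma csesqD V W k (F F' : k.-tuple V -> pmod W k.-1) :
  csesq F -> csesq F' -> csesq (fun a => F a + F' a).
Proof.
move=> /csesqP[l i e] /csesqP[l' i' e']; apply/csesqP.
split => [a j c x y|a j x jk|a j x jk].
- by rewrite l l' addrACA -raddfD.
- by rewrite i // i' // -opprD -raddfD.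
- by rewrite e // e' // addrACA -!raddfD.
Qed.

Lemma csesqN V W k (F : k.-tuple V -> pmod W k.-1) :
  csesq F -> csesq (fun a => - F a).
Proof.
move=> /csesqP[l i e]; apply/csesqP; split => [a j c x y|a j x jk|a j x jk].
- by rewrite l opprD raddfN.
- by rewrite i // (raddfN (act_pm _)).
- by rewrite e // opprD (raddfN (act_pm _)) (raddfN (map_pm _)).
Qed.

Lemma upd_map U V k (f : U -> V) (a : k.-tuple U) i x :
  map_tuple f (upd a i x) = upd (map_tuple f a) i (f x).
Proof.
by apply: eq_from_tnth => j; rewrite !(tnth_map, tnth_mktuple); case: eqP.
Qed.

Lemma csesq_comp U V W W' k (f : {linear U -> V}) (g : {linear W -> W'})
    (F : k.-tuple V -> pmod W k.-1) :
  csesq F -> csesq (fun a => map_pm g (F (map_tuple f a))).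
Proof.
move=> /csesqP[l i e]; apply/csesqP; split => [a j c x y|a j x jk|a j x jk].
- by rewrite !upd_map linearP l raddfD /= map_pm_scale.
- by rewrite !upd_map linearZ i // raddfN /= map_pm_act.
- by rewrite !upd_map linearZ e // raddfD /= map_pm_scale map_pm_act.
Qed.

Lemma csesq2_comp U U' V V' W W' (f : {linear U' -> U}) (g : {linear V' -> V})
    (h : {linear W -> W'}) (F : U -> V -> pmod W 1) :
  csesq2 F -> csesq2 (fun x y => map_pm h (F (f x) (g y))).
Proof.
move=> /csesq2P[l r dl dr]; apply/csesq2P; split=> [c a a' b|c a b b'|a b|a b].
- by rewrite linearP l raddfD /= map_pm_scale.
- by rewrite linearP r raddfD /= map_pm_scale.
- by rewrite linearZ dl raddfN /= map_pm_act.
- by rewrite linearZ dr raddfD /= map_pm_scale map_pm_act.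
Qed.

Lemma csesq2D U V W (f f' : U -> V -> pmod W 1) :
  csesq2 f -> csesq2 f' -> csesq2 (fun x y => f x y + f' x y).
Proof.
move=> /csesq2P[l r dl dr] /csesq2P[l' r' dl' dr']; apply/csesq2P.
split=> [c a a' b|c a b b'|a b|a b].
- by rewrite l l' addrACA -raddfD.
- by rewrite r r' addrACA -raddfD.
- by rewrite dl dl' -opprD -raddfD.
- by rewrite dr dr' addrACA -!raddfD.
Qed.

Lemma nth_upd V k (a : k.-tuple V) (i : 'I_k) x j : (j < k)%N ->
  (upd a i x)`_j = if j == i then x else a`_j.
Proof.
move=> jk; rewrite -(tnth_nth 0 _ (Ordinal jk)) tnth_mktuple (tnth_nth 0).
by rewrite -val_eqE.
Qed.

Lemma csesq_csesq2 V W (f : V -> V -> pmod W 1) :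
  csesq2 f -> csesq (fun a : 2.-tuple V => f a`_0 a`_1).
Proof.
case/csesq2P=> l r dl dr; apply/csesqP; split=> a i.
- by case: i => -[|[|]] //= i2 c x y; rewrite !nth_upd //= ?l ?r.
- by case: i => -[|[|]] //= i2 x _; rewrite !nth_upd //= dl.
- by case: i => -[|[|]] //= i2 x _; rewrite !nth_upd //= dr big_ord1.
Qed.

Lemma csesq2_csesq V W (F : 2.-tuple V -> pmod W 1) :
  csesq F -> csesq2 (fun x y => F [tuple x; y]).
Proof.
have u0 (x y z : V) : upd [tuple x; y] ord0 z = [tuple z; y].
  by apply: eq_from_tnth => -[[|[|]]] // i; rewrite tnth_mktuple.
have u1 (x y z : V) : upd [tuple x; y] ord_max z = [tuple x; z].
  by apply: eq_from_tnth => -[[|[|]]] // i; rewrite tnth_mktuple.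
case/csesqP=> l i e; apply/csesq2P; split=> [c a a' b|c a b b'|a b|a b].
- by rewrite -(u0 0) l !u0.
- by rewrite -(u1 a 0) l !u1.
- by rewrite -(u0 0) i // !u0.
- by rewrite -(u1 a 0) e // !u1 big_ord1.
Qed.

(** The entries are freed from [P] one at a time: by induction on [s], equality holds when only the
    entries from position [s] on satisfy [P], since the next entry can be split as y + z and both
    maps are additive in it. *)
Lemma csesq_ext V W k (P : V -> Prop) (F F' : k.-tuple V -> pmod W k.-1) :
    (forall x, exists y z, [/\ P y, P z & x = y + z]) ->
    csesq F -> csesq F' ->
    (forall a, (forall j, P (tnth a j)) -> F a = F' a) ->
  F =1 F'.
Proof.
move=> genP sF sF' FF'.
have: forall s (a : k.-tuple V), (forall j : 'I_k, (s <= j)%N -> P (tnth a j)) -> F a = F' a.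
  elim=> [|s IH] a Pa; first by apply: FF' => j; apply: Pa.
  have [ks|sk] := leqP k s.
    by apply: IH => j sj; have := leq_trans (ltn_ord j) ks; rewrite ltnNge sj.
  pose i := Ordinal sk; have [y [z [Py Pz yz]]] := genP (tnth a i).
  have -> : a = upd a i (y + z).
    by apply: eq_from_tnth => j; rewrite tnth_mktuple -yz; case: eqP => [->|].
  rewrite !csesq_updD //; congr (_ + _); apply: IH => j sj; rewrite tnth_mktuple;
  case: eqP => // ij; apply: Pa; rewrite ltn_neqAle sj andbT;
  apply: contra_notN ij => /eqP ij; exact/val_inj.
by move=> h a; apply: (h k) => j; rewrite leqNgt ltn_ord.
Qed.

End Sesquilinear.

(** * Gluing the components of a skeletal structure *)

Lemma csesq_eq0 (C : fieldType) (V W : lmodType {poly C}) k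
    (F : k.-tuple V -> pmod W k.-1) a (i : 'I_k) :
  csesq F -> tnth a i = 0 -> F a = 0.
Proof.
move=> sF ai; have ua : upd a i 0 = a.
  by apply: eq_from_tnth => j; rewrite tnth_mktuple; case: eqP => // ->.
by apply: (addrI (F a)); rewrite -{1 2}ua -csesq_updD // !addr0 ua.
Qed.

Section Graded.
Context (C : fieldType) (G : graded_module C).

Lemma gr_pr_inj (x y : G) : (forall d, gr_pr G d x = gr_pr G d y) -> x = y.
Proof.
move=> xy; apply/eqP; rewrite -subr_eq0; apply/eqP.
have [s _ ->] := gr_sum (x - y); apply: big1 => d _.
by rewrite raddfB /= xy subrr raddf0.
Qed.

Lemma map_pm_in_degree r d (q : pmod G r) :
  (forall m, in_degree d (q@_m)) -> q = map_pm (gr_in G d) (map_pm (gr_pr G d) q).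
Proof.
move=> qd; apply/malgP => m; rewrite !map_pmE ?raddf0 //.
by have [y ->] := qd m; rewrite gr_inK.
Qed.

(** A structure needs a map in each arity, while the data provide two of them. The type of the map
    depends on the arity, so it is transported along a decided equation; on the diagonal this
    transport is trivial by uniqueness of identity proofs on [nat]. *)
Definition at_arity k0 (f : k0.-tuple G -> pmod G k0.-1) k :
    k.-tuple G -> pmod G k.-1 :=
  match @eqP _ k0 k with
  | ReflectT e => ecast k (k.-tuple G -> pmod G k.-1) e f
  | ReflectF _ => fun=> 0
  end.

Lemma at_arityE k (f : k.-tuple G -> pmod G k.-1) : at_arity f (k := k) = f.
Proof. by rewrite /at_arity; case: eqP => // e; rewrite eq_axiomK. Qed.

Lemma at_arity_neq k0 (f : k0.-tuple G -> pmod G k0.-1) k a :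
  k0 != k -> at_arity f a = 0 :> pmod G k.-1.
Proof. by rewrite /at_arity; case: eqP. Qed.

Lemma csesq_at_arity k0 (f : k0.-tuple G -> pmod G k0.-1) k :
  csesq f -> csesq (@at_arity k0 f k).
Proof.
move=> sf; rewrite /at_arity; case: eqP => [e|_]; last exact: csesq0.
by case: k / e.
Qed.

End Graded.

Section Skeletal.
Context (C : fieldType) (n : nat) (n_gt1 : (1 < n)%N).
Context (G : graded_module C) (supp : skeletal_support n G).
Local Notation t := (n.-1%:Z).
Local Notation A := (gr G 0).
Local Notation M := (gr G n.-1%:Z).
Local Notation i0 := (gr_in G 0).
Local Notation it := (gr_in G n.-1%:Z).
Local Notation p0 := (gr_pr G 0).
Local Notation pt := (gr_pr G n.-1%:Z).

Lemma top_neq0 : t != 0.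
Proof. by lia. Qed.

Lemma pr0_in0 x : p0 (i0 x) = x. Proof. exact: gr_inK. Qed.
Lemma prt_int x : pt (it x) = x. Proof. exact: gr_inK. Qed.
Lemma prt_in0 x : pt (i0 x) = 0.
Proof. by apply: gr_pr_in; rewrite eq_sym top_neq0. Qed.
Lemma pr0_int x : p0 (it x) = 0.
Proof. by apply: gr_pr_in; exact: top_neq0. Qed.
Definition prE := (pr0_in0, prt_int, prt_in0, pr0_int).

Lemma gr_trivial d (x : gr G d) : d != 0 -> d != t -> x = 0.
Proof. by move=> d0 dt; case: supp => _ h; exact: h. Qed.

Lemma in_degree_trivial d (x : G) : d != 0 -> d != t -> in_degree d x -> x = 0.
Proof. by move=> d0 dt [y ->]; rewrite (gr_trivial y) // raddf0. Qed.

Lemma gr_decomp (x : G) : x = i0 (p0 x) + it (pt x).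
Proof.
apply: gr_pr_inj => d; rewrite raddfD /=.
have [->|d0] := eqVneq d 0; first by rewrite !prE addr0.
have [->|dt] := eqVneq d t; first by rewrite !prE add0r.
by apply: etrans (esym _); exact: gr_trivial.
Qed.

Section Structure.
Context (mul : A -> A -> pmod A 1) (l : A -> M -> pmod M 1) (r : M -> A -> pmod M 1).
Context (theta : n.+1.-tuple A -> pmod M n).

(** The product of the split square-zero extension of A by M. A product of two elements of M would
    have degree 2(n - 1), outside the support, hence no term in [pt] and [pt]. *)
Definition glue2 (a : 2.-tuple G) : pmod G 1 :=
  map_pm i0 (mul (p0 a`_0) (p0 a`_1)) +
  map_pm it (l (p0 a`_0) (pt a`_1) + r (pt a`_0) (p0 a`_1)).

Definition glue_top (a : n.+1.-tuple G) : pmod G n :=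
  map_pm it (theta (map_tuple p0 a)).

(** As n > 1, the arities 2 and n + 1 differ and at most one summand is nonzero. *)
Definition glue k (a : k.-tuple G) : pmod G k.-1 :=
  at_arity glue2 a + at_arity glue_top a.

Lemma glue_2 : @glue 2 = glue2.
Proof.
by apply/funext => a; rewrite /glue at_arityE at_arity_neq ?addr0 //; lia.
Qed.

Lemma glue_n1 : @glue n.+1 = glue_top.
Proof.
by apply/funext => a; rewrite /glue at_arityE at_arity_neq ?add0r //; lia.
Qed.

Lemma glue_0 k a : k != 2%N -> k != n.+1 -> @glue k a = 0.
Proof. by move=> k2 kn; rewrite /glue !at_arity_neq ?addr0 // eq_sym. Qed.

Hypotheses (smul : csesq2 mul) (sl : csesq2 l) (sr : csesq2 r).
Hypothesis (stheta : csesq (theta : _ -> pmod M n.+1.-1)).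

Lemma csesq_glue2 : csesq glue2.
Proof.
pose f x y : pmod G 1 := map_pm i0 (mul (p0 x) (p0 y)) +
  (map_pm it (l (p0 x) (pt y)) + map_pm it (r (pt x) (p0 y))).
have -> : glue2 = fun a : 2.-tuple G => f a`_0 a`_1.
  by apply/funext => a; rewrite /glue2 raddfD.
apply: csesq_csesq2; apply: csesq2D; first exact: csesq2_comp.
by apply: csesq2D; exact: csesq2_comp.
Qed.

Lemma csesq_glue k : csesq (@glue k).
Proof.
apply: csesqD; apply: csesq_at_arity; first exact: csesq_glue2.
exact: (csesq_comp p0 it stheta).
Qed.

End Structure.

Section Components.
Context (S : skeletal n G).

Lemma csesq2_mu2_at d e f : csesq2 (@mu2_at _ _ _ S d e f).
Proof.
rewrite /mu2_at pmod_mapL.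
exact: (csesq2_comp _ _ _ (csesq2_csesq (mu_sesq S (k := 2) isT))).
Qed.

Lemma csesq_sk_top : csesq (sk_top S : n.+1.-tuple _ -> pmod _ n.+1.-1).
Proof.
rewrite /sk_top pmod_mapL.
exact: (csesq_comp _ _ (mu_sesq S (k := n.+1) isT)).
Qed.

Lemma mu_homogeneous k (d : k.-tuple int) (a : k.-tuple G) (e : int) :
    (0 < k)%N -> (forall j, in_degree (tnth d j) (tnth a j)) ->
    \sum_(j < k) tnth d j + k%:Z - 2 = e ->
  S k a = map_pm (gr_in G e) (map_pm (gr_pr G e) (S k a)).
Proof.
by move=> k0 da <-; apply: map_pm_in_degree => m; exact: mu_degree.
Qed.

Lemma mu_trivial k (d : k.-tuple int) (a : k.-tuple G) :
    (0 < k)%N -> (forall j, in_degree (tnth d j) (tnth a j)) ->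
    \sum_(j < k) tnth d j + k%:Z - 2 != 0 ->
    \sum_(j < k) tnth d j + k%:Z - 2 != t ->
  S k a = 0.
Proof.
move=> k0 da d0 dt; apply/malgP => m; rewrite monalg.mcoeff0.
exact: in_degree_trivial d0 dt (mu_degree S k0 da m).
Qed.

Lemma skeletal_glue2 (x y : G) :
    in_degree 0 x \/ in_degree t x -> in_degree 0 y \/ in_degree t y ->
  S 2 [tuple x; y] = glue2 (sk_mul S) (sk_l S) (sk_r S) [tuple x; y].
Proof.
have hom dx dy : in_degree dx x -> in_degree dy y ->
    forall j, in_degree (tnth [tuple dx; dy] j) (tnth [tuple x; y] j).
  by move=> hx hy -[[|[|]]].
have sum2 (dx dy : int) : \sum_(j < 2) tnth [tuple dx; dy] j = dx + dy.
  by rewrite !big_ord_recl big_ord0 addr0.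
have [ml lz rz] := And3 (csesq2_mu2_at 0 0 0) (csesq2_mu2_at 0 t t) (csesq2_mu2_at t 0 t).
have m0x u : sk_mul S 0 u = 0 by exact: morphD0 (csesq2Dl u ml).
have mx0 u : sk_mul S u 0 = 0 by exact: morphD0 (csesq2Dr u ml).
have l0x u : sk_l S 0 u = 0 by exact: morphD0 (csesq2Dl u lz).
have lx0 u : sk_l S u 0 = 0 by exact: morphD0 (csesq2Dr u lz).
have r0x u : sk_r S 0 u = 0 by exact: morphD0 (csesq2Dl u rz).
have rx0 u : sk_r S u 0 = 0 by exact: morphD0 (csesq2Dr u rz).
rewrite /glue2 /=.
case=> [[u xu]|[u xu]] [[v yv]|[v yv]].
- rewrite (mu_homogeneous (e := 0) _ (hom 0 0 _ _)) ?sum2; try by [|exists u|exists v].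
  by rewrite xu yv !prE lx0 r0x !(addr0, raddf0) /sk_mul /mu2_at pmod_mapL.
- rewrite (mu_homogeneous (e := t) _ (hom 0 t _ _)) ?sum2; try by [lia|exists u|exists v].
  by rewrite xu yv !prE mx0 r0x !(addr0, raddf0, add0r) /sk_l /mu2_at pmod_mapL.
- rewrite (mu_homogeneous (e := t) _ (hom t 0 _ _)) ?sum2; try by [lia|exists u|exists v].
  by rewrite xu yv !prE m0x l0x !(addr0, raddf0, add0r) /sk_r /mu2_at pmod_mapL.
- rewrite (mu_trivial _ (hom t t _ _)) ?sum2; try by [lia|exists u|exists v].
  by rewrite xu yv !prE mx0 l0x rx0 !(addr0, raddf0).
Qed.

(** Both sides are sesquilinear and every element is a sum of components of degrees 0 and n - 1, so
    it suffices to compare them on such homogeneous entries, where the degree of the value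
    decides. *)
Lemma skeletal_glue k (a : k.-tuple G) :
  S k a = glue (sk_mul S) (sk_l S) (sk_r S) (sk_top S) a.
Proof.
case: k a => [|k]; first by move=> a; rewrite glue_0 // mu_0.
have genP (x : G) : exists y z,
    [/\ in_degree 0 y \/ in_degree t y, in_degree 0 z \/ in_degree t z & x = y + z].
  exists (i0 (p0 x)), (it (pt x)); split; last exact: gr_decomp.
    by left; exists (p0 x).
  by right; exists (pt x).
have sS := mu_sesq S (k := k.+1) isT.
have sg := csesq_glue (csesq2_mu2_at 0 0 0) (csesq2_mu2_at 0 t t)
  (csesq2_mu2_at t 0 t) csesq_sk_top k.+1.
apply: (csesq_ext genP sS sg) => a Pa {sS sg}.
(* A zero entry has both degrees; degree 0 is then preferred. *)
pose d := [tuple if `[<in_degree 0 (tnth a j)>] then 0%:Z else t | j < k.+1].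
have da j : in_degree (tnth d j) (tnth a j).
  rewrite tnth_mktuple; case: asboolP => // nd.
  by case: (Pa j).
have d01 j : tnth d j = 0 \/ tnth d j = t.
  by rewrite tnth_mktuple; case: ifP => _; [left|right].
(* The value has degree the sum plus the arity minus 2, so a single entry of degree n - 1 pushes it
   beyond n - 1 as soon as the arity exceeds 2. *)
have dge : (exists j, tnth d j != 0) -> t <= \sum_(j < k.+1) tnth d j.
  case=> j0 dj0; have dt : tnth d j0 = t by case: (d01 j0) dj0 => ->.
  rewrite (bigD1 j0) //= dt lerDl sumr_ge0 // => j _.
  by case: (d01 j) => ->.
have d0 : (exists j, tnth d j != 0) \/ (forall j, tnth d j = 0).
  have [|nd] := pselect (exists j, tnth d j != 0); first by left.
  by right=> j; apply: contra_notP nd => /eqP; exists j.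
clearbody d.
have [kn|kn] := eqVneq k n.
  subst k; rewrite glue_n1 /glue_top; case: d0 => [[j dj]|d0].
    have dt : tnth d j = t by case: (d01 j) dj => ->.
    rewrite (mu_trivial _ da) //; try by have := dge (ex_intro _ j dj); lia.
    rewrite (csesq_eq0 (i := j) csesq_sk_top) ?raddf0 // tnth_map.
    by have := da j; rewrite dt => -[u ->]; rewrite pr0_int.
  have ds : \sum_(j < n.+1) tnth d j = 0 by apply: big1 => j _; exact: d0.
  rewrite (mu_homogeneous (e := t) _ da) ?ds //; last by lia.
  congr map_pm; rewrite /sk_top pmod_mapL; congr (map_pm _ (S n.+1 _)).
  apply: eq_from_tnth => j; rewrite !tnth_map.
  by have := da j; rewrite d0 => -[u ->]; rewrite pr0_in0.
case: k kn a Pa d da d01 dge d0 => [|[|k]] kn a Pa d da d01 dge d0.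
- by rewrite glue_0 // ?sk_mu1 //; lia.
- have -> : a = [tuple tnth a ord0; tnth a ord_max].
    by apply: eq_from_tnth => -[[|[|]]] // i; congr tnth; exact: val_inj.
  by rewrite glue_2 //; exact: skeletal_glue2.
(* The arity is k + 3, different from n + 1. With all entries in degree 0 the value has degree k +
   1, which is neither 0 nor n - 1. *)
rewrite glue_0 //; case: d0 => [/dge dt|d0].
  by rewrite (mu_trivial _ da) //; lia.
have ds : \sum_(j < k.+3) tnth d j = 0 by apply: big1 => j _; exact: d0.
by rewrite (mu_trivial _ da) // ds; lia.
Qed.

Lemma skeletal_mu2 a : S 2 a = glue2 (sk_mul S) (sk_l S) (sk_r S) a.
Proof. by rewrite skeletal_glue glue_2. Qed.

End Components.

End Skeletal.

(** * The A-infinity identities of a glued structure *)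

(* [pcomp] alone is [ssrfun.pcomp] here. *)
Local Notation pcomp := (@Defs.pcomp _ _ _ _ _ _).

(** The three terms with values in M on the two sides of glued associativity come out in cyclically
    shifted order: b matches a', c matches b' and a matches c'. This isolates one pair; [addr3_rot]
    reassembles the three. *)
Lemma addr3_eq (V : zmodType) (a b c a' b' c' : V) : a + b + c = a' + b' + c' ->
  [/\ a = 0 -> c = 0 -> b' = 0 -> c' = 0 -> b = a',
      a = 0 -> b = 0 -> a' = 0 -> c' = 0 -> c = b'
    & b = 0 -> c = 0 -> a' = 0 -> b' = 0 -> a = c'].
Proof.
by move=> e; split=> e1 e2 e3 e4; move: e; rewrite e1 e2 e3 e4 ?add0r ?addr0.
Qed.

Lemma addr3_rot (V : zmodType) (a b c a' b' c' : V) :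
  a = c' -> b = a' -> c = b' -> a + b + c = a' + b' + c'.
Proof. by move=> -> -> ->; rewrite -addrA addrC. Qed.

Lemma nth_map_tuple (U V : zmodType) (f : {additive U -> V}) k (a : k.-tuple U) j :
  (map_tuple f a)`_j = f a`_j.
Proof.
have [jk|kj] := ltnP j k; first by rewrite (nth_map 0) ?size_tuple.
by rewrite !nth_default ?size_tuple ?raddf0.
Qed.

Lemma nth_mktuple_nat (U : zmodType) k (f : nat -> U) j : (j < k)%N ->
  [tuple f i | i < k]`_j = f j.
Proof. by move=> jk; rewrite (nth_mktuple _ _ (Ordinal jk)). Qed.

Lemma exprN1_addM2 (x y z : int) : x = y + 2 * z -> (-1 : int) ^ x = (-1) ^ y.
Proof.
by move=> ->; rewrite exprzDr ?unitrN1 // -exprz_exp -exprnP sqrrN expr1n exp1rz mulr1.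
Qed.

Lemma slot_first (U : Type) (a : nat -> U) l x :
  [tuple if (j < 0)%N then a j else if j == 0 :> nat then x else a (j + l).-1
    | j < 2] = [tuple x; a l].
Proof. by apply: eq_from_tnth => -[[|[|]]] // j; rewrite tnth_mktuple. Qed.

Lemma slot_last (U : Type) (a : nat -> U) l x :
  [tuple if (j < 1)%N then a j else if j == 1 :> nat then x else a (j + l).-1
    | j < 2] = [tuple a 0; x].
Proof. by apply: eq_from_tnth => -[[|[|]]] // j; rewrite tnth_mktuple. Qed.

Section Comp0.
Context (C : fieldType) (U V W : lmodType {poly C}) (f : U -> V -> pmod W 1).
Hypothesis sf : csesq2 f.

Lemma lcomp0l q : lcomp f 0 q = 0.
Proof. by rewrite /lcomp plugL plug0l // => x; exact: morphD0 (csesq2Dl x sf). Qed.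

Lemma lcomp0r a : lcomp f a 0 = 0.
Proof. by rewrite /lcomp plugL plug0r. Qed.

Lemma rcomp0l b : rcomp f 0 b = 0.
Proof. by rewrite /rcomp plugL plug0r. Qed.

Lemma rcomp0r q : rcomp f q 0 = 0.
Proof. by rewrite /rcomp plugL plug0l // => x; exact: morphD0 (csesq2Dr x sf). Qed.

End Comp0.

Section Composition.
Context (C : fieldType) (V W : lmodType {poly C}) (k l N : nat).
Context (F : k.-tuple V -> pmod W k.-1) (H : l.-tuple V -> pmod V l.-1).

Lemma csesq_slotD i (a : nat -> V) : csesq F -> (i < k)%N ->
  {morph (fun x => F [tuple if (j < i)%N then a j
                   else if j == i :> nat then x else a (j + l).-1 | j < k]) :
     x y / x + y}.
Proof.
move=> sF ik x y.
pose b := [tuple if (j < i)%N then a j else a (j + l).-1 | j < k].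
have slot z : [tuple if (j < i)%N then a j
    else if j == i :> nat then z else a (j + l).-1 | j < k] = upd b (Ordinal ik) z.
  apply: eq_from_tnth => j; rewrite !tnth_mktuple -val_eqE /=.
  by case: ltngtP.
by rewrite !slot csesq_updD.
Qed.

Lemma pcompDl (F' : k.-tuple V -> pmod W k.-1) i (a : N.-tuple V) :
  pcomp i (fun b => F b + F' b) H a = pcomp i F H a + pcomp i F' H a.
Proof. by rewrite /pcomp plugL -plugDl. Qed.

Lemma pcomp0r i (a : N.-tuple V) : (forall b, H b = 0) -> pcomp i F H a = 0.
Proof. by move=> H0; rewrite /pcomp plugL H0 plug0r. Qed.

Lemma pcomp0l i (a : N.-tuple V) : (forall b, F b = 0) -> pcomp i F H a = 0.
Proof.
by move=> F0; rewrite /pcomp plugL plug0l.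
Qed.

End Composition.

Section Glue.
Context (C : fieldType) (n : nat) (n_gt1 : (1 < n)%N) (G : graded_module C).
Local Notation t := (n.-1%:Z).
Local Notation A := (gr G 0).
Local Notation M := (gr G n.-1%:Z).
Local Notation i0 := (gr_in G 0).
Local Notation it := (gr_in G n.-1%:Z).
Local Notation p0 := (gr_pr G 0).
Local Notation pt := (gr_pr G n.-1%:Z).

Lemma map_pr0_in0 r (q : pmod A r) : map_pm p0 (map_pm i0 q) = q.
Proof.
rewrite map_pm_comp ?raddf0 // -[RHS]map_pm_id; apply: eq_map_pm => x.
exact: pr0_in0.
Qed.

Lemma map_prt_int r (q : pmod M r) : map_pm pt (map_pm it q) = q.
Proof.
rewrite map_pm_comp ?raddf0 // -[RHS]map_pm_id; apply: eq_map_pm => x.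
exact: prt_int.
Qed.

Lemma map_prt_in0 r (q : pmod A r) : map_pm pt (map_pm i0 q) = 0.
Proof.
rewrite map_pm_comp ?raddf0 // -[RHS](map_pm0 _ q); apply: eq_map_pm => x.
exact: prt_in0.
Qed.

Lemma map_pr0_int r (q : pmod M r) : map_pm p0 (map_pm it q) = 0.
Proof.
rewrite map_pm_comp ?raddf0 // -[RHS](map_pm0 _ q); apply: eq_map_pm => x.
exact: pr0_int.
Qed.

Lemma map_in0_int_inj r (p q : pmod A r) (p' q' : pmod M r) :
  map_pm i0 p + map_pm it p' = map_pm i0 q + map_pm it q' -> p = q /\ p' = q'.
Proof.
move=> e; split.
  have := congr1 (map_pm p0) e.
  by rewrite !(raddfD (map_pm p0)) /= !map_pr0_in0 !map_pr0_int !addr0.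
have := congr1 (map_pm pt) e.
by rewrite !(raddfD (map_pm pt)) /= !map_prt_in0 !map_prt_int !add0r.
Qed.

Context (mul : A -> A -> pmod A 1) (l : A -> M -> pmod M 1) (r : M -> A -> pmod M 1).
Context (theta : n.+1.-tuple A -> pmod M n).
Hypotheses (smul : csesq2 mul) (sl : csesq2 l) (sr : csesq2 r).
Hypothesis (stheta : csesq (theta : _ -> pmod M n.+1.-1)).

Let mul0x x : mul 0 x = 0. Proof. exact: morphD0 (csesq2Dl x smul). Qed.
Let mulx0 x : mul x 0 = 0. Proof. exact: morphD0 (csesq2Dr x smul). Qed.
Let l0x x : l 0 x = 0. Proof. exact: morphD0 (csesq2Dl x sl). Qed.
Let lx0 x : l x 0 = 0. Proof. exact: morphD0 (csesq2Dr x sl). Qed.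
Let r0x x : r 0 x = 0. Proof. exact: morphD0 (csesq2Dl x sr). Qed.
Let rx0 x : r x 0 = 0. Proof. exact: morphD0 (csesq2Dr x sr). Qed.

Local Notation g2 := (glue2 mul l r).
Local Notation gt := (glue_top theta).
Local Notation g := (glue mul l r theta).

Let sg2 : csesq g2. Proof. exact: csesq_glue2. Qed.
Let sgt : csesq (gt : _ -> pmod G n.+1.-1).
Proof. exact: (csesq_comp p0 it stheta). Qed.

Lemma map_pr0_glue2 a : map_pm p0 (g2 a) = mul (p0 a`_0) (p0 a`_1).
Proof. by rewrite raddfD /= map_pr0_in0 map_pr0_int addr0. Qed.

Lemma map_prt_glue2 a :
  map_pm pt (g2 a) = l (p0 a`_0) (pt a`_1) + r (pt a`_0) (p0 a`_1).
Proof. by rewrite raddfD /= map_prt_in0 map_prt_int add0r. Qed.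

(** The inner value lies in degree n - 1 and is killed by the [p0] through which [theta] reads its
    arguments. *)
Lemma pcomp_top_top N i (a : N.-tuple G) : (i < n.+1)%N ->
  pcomp i (gt : _ -> pmod G n.+1.-1) (gt : _ -> pmod G n.+1.-1) a = 0.
Proof.
move=> iN; rewrite /pcomp plugL plug_map_r; last by apply: csesq_slotD.
apply: plug0l => x.
rewrite /glue_top (csesq_eq0 (i := Ordinal iN) stheta) ?raddf0 //.
by rewrite tnth_map tnth_mktuple /= ltnn eqxx pr0_int.
Qed.

(** Among the parts of the inner product, [p0] lets only [mul] through; what remains is an inner
    term of the coboundary. *)
Lemma pcomp_top_2 N i (a : N.-tuple G) : (i < n.+1)%N ->
  pcomp i (gt : _ -> pmod G n.+1.-1) g2 a =
  map_pm it (pcomp i (theta : _ -> pmod M n.+1.-1)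
    (fun b : 2.-tuple A => mul b`_0 b`_1) (map_tuple p0 a)).
Proof.
move=> iN; rewrite /pcomp plugL plug_map_l; congr map_pm.
have -> : (fun b : 2.-tuple A => mul b`_0 b`_1)
    [tuple (map_tuple p0 a)`_(i + j) | j < 2] = map_pm p0 (g2 [tuple a`_(i + j) | j < 2]).
  by rewrite map_pr0_glue2 !(nth_mktuple_nat (fun j => _`_(i + j))) // !nth_map_tuple.
rewrite plug_map_r; last by apply: csesq_slotD.
apply: eq_plug => // x; congr theta; apply: eq_from_tnth => j.
by rewrite tnth_map !tnth_mktuple !nth_map_tuple; case: ifP => // _; case: ifP.
Qed.

(** The inner value lies in M, so in slot 0 of [glue2] only the right action sees it. Slot 0 thus
    yields the last term of the coboundary, and slot 1, in the next lemma, the first one. *)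
Lemma pcomp_2_top_first N (a : N.-tuple G) :
  pcomp 0 g2 (gt : _ -> pmod G n.+1.-1) a =
  map_pm it (plug_pm (fun j => lam C N.-1 j) (fun=> \sum_(0 <= s < n.+1) lam C N.-1 s)
    (fun x => r x (map_tuple p0 a)`_n.+1)
    (theta [tuple (map_tuple p0 a)`_j | j < n.+1])).
Proof.
rewrite /pcomp plugL plug_map_r; last exact: (csesq_slotD _ (i := 0) (fun j => a`_j) sg2 isT).
rewrite -plug_map_l.
have -> : map_tuple p0 [tuple a`_(0 + j) | j < n.+1] =
    [tuple (map_tuple p0 a)`_j | j < n.+1].
  by apply: eq_from_tnth => j; rewrite tnth_map !tnth_mktuple nth_map_tuple.
apply: eq_plug => [//|[|]//|x].
rewrite (slot_first (fun j => a`_j)) /glue2 /=.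
by rewrite pr0_int // prt_int // mul0x l0x add0r raddf0 add0r nth_map_tuple.
Qed.

Lemma pcomp_2_top_last N (a : N.-tuple G) :
  pcomp 1 g2 (gt : _ -> pmod G n.+1.-1) a =
  map_pm it (plug_pm (fun j => lam C N.-1 j.+1) (fun=> lam C N.-1 0)
    (l (map_tuple p0 a)`_0)
    (theta [tuple (map_tuple p0 a)`_j.+1 | j < n.+1])).
Proof.
rewrite /pcomp plugL plug_map_r; last exact: (csesq_slotD _ (i := 1) (fun j => a`_j) sg2 isT).
rewrite -plug_map_l.
have -> : map_tuple p0 [tuple a`_(1 + j) | j < n.+1] =
    [tuple (map_tuple p0 a)`_j.+1 | j < n.+1].
  by apply: eq_from_tnth => j; rewrite tnth_map !tnth_mktuple nth_map_tuple.
apply: eq_plug => [//|[|]//|x].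
rewrite (slot_last (fun j => a`_j)) /glue2 /=.
by rewrite pr0_int // prt_int // mulx0 rx0 addr0 raddf0 add0r nth_map_tuple.
Qed.

(** The part of the inner product in A feeds [mul] and [l], its two parts in M feed [r]. With the
    inner product in slot 1 instead, the roles of [l] and [r] are exchanged. *)
Lemma pcomp_2_2_first (a : 3.-tuple G) :
  pcomp 0 g2 g2 a =
  map_pm i0 (rcomp mul (mul (p0 a`_0) (p0 a`_1)) (p0 a`_2)) +
  map_pm it (rcomp l (mul (p0 a`_0) (p0 a`_1)) (pt a`_2) +
    rcomp r (l (p0 a`_0) (pt a`_1)) (p0 a`_2) +
    rcomp r (r (pt a`_0) (p0 a`_1)) (p0 a`_2)).
Proof.
have F0D := csesq_slotD 2 (i := 0) (fun j => a`_j) sg2 isT.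
rewrite /pcomp plugL plugDr // !plug_map_r //.
rewrite !(nth_mktuple_nat (fun j => a`_(0 + j))) //.
have sub0 i : (i < 1)%N -> (if (i < 0)%N then lam C 2 i
    else if i == 0 then \sum_(0 <= s < 0 + 2) lam C 2 s else lam C 2 (i + 2).-1) =
    lam C 2 0 + lam C 2 1.
  by case: i => //= _; rewrite !big_nat_recl // big_geq // addr0.
rewrite !raddfD /= addrA addrA -[RHS]addrA /rcomp plugL; congr (_ + _).
  rewrite -!plug_map_l -plugDl; apply: eq_plug => [[|]//|//|x].
  by rewrite (slot_first (fun j => a`_j)) /glue2 /= !prE // r0x addr0.
rewrite plugDr => [|x y]; last by rewrite raddfD F0D.
by congr (_ + _); rewrite -plug_map_l; apply: eq_plug => [[|]//|//|x];
  rewrite (slot_first (fun j => a`_j)) /glue2 /= !prE // mul0x l0x raddf0 !add0r.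
Qed.

Lemma pcomp_2_2_last (a : 3.-tuple G) :
  pcomp 1 g2 g2 a =
  map_pm i0 (lcomp mul (p0 a`_0) (mul (p0 a`_1) (p0 a`_2))) +
  map_pm it (lcomp r (pt a`_0) (mul (p0 a`_1) (p0 a`_2)) +
    lcomp l (p0 a`_0) (l (p0 a`_1) (pt a`_2)) +
    lcomp l (p0 a`_0) (r (pt a`_1) (p0 a`_2))).
Proof.
have F0D := csesq_slotD 2 (i := 1) (fun j => a`_j) sg2 isT.
rewrite /pcomp plugL plugDr // !plug_map_r //.
rewrite !(nth_mktuple_nat (fun j => a`_(1 + j))) //.
rewrite !raddfD /= addrA addrA -[RHS]addrA /lcomp plugL; congr (_ + _).
  rewrite -!plug_map_l -plugDl; apply: eq_plug => [[|]//|[|]//|x].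
  by rewrite (slot_last (fun j => a`_j)) /glue2 /= !prE // lx0 add0r.
rewrite plugDr => [|x y]; last by rewrite raddfD F0D.
by congr (_ + _); rewrite -plug_map_l; apply: eq_plug => [[|]//|[|]//|x];
  rewrite (slot_last (fun j => a`_j)) /glue2 /= !prE // mulx0 rx0 raddf0 add0r addr0.
Qed.

(** Associativity of the square-zero extension, by components: the part in M is the sum of the three
    bimodule axioms. *)
Definition glue_assoc (x y z : G) : Prop :=
  map_pm i0 (lcomp mul (p0 x) (mul (p0 y) (p0 z))) +
  map_pm it (lcomp r (pt x) (mul (p0 y) (p0 z)) +
    lcomp l (p0 x) (l (p0 y) (pt z)) +
    lcomp l (p0 x) (r (pt y) (p0 z))) =
  map_pm i0 (rcomp mul (mul (p0 x) (p0 y)) (p0 z)) +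
  map_pm it (rcomp l (mul (p0 x) (p0 y)) (pt z) +
    rcomp r (l (p0 x) (pt y)) (p0 z) +
    rcomp r (r (pt x) (p0 y)) (p0 z)).

Lemma glue_assocP x y z :
  pcomp 1 g2 g2 [tuple x; y; z] = pcomp 0 g2 g2 [tuple x; y; z] <->
  glue_assoc x y z.
Proof. by rewrite pcomp_2_2_first pcomp_2_2_last. Qed.

Lemma glue_assoc_mul x y z : glue_assoc (i0 x) (i0 y) (i0 z) ->
  lcomp mul x (mul y z) = rcomp mul (mul x y) z.
Proof. by case/map_in0_int_inj; rewrite !pr0_in0. Qed.

(** With exactly one entry taken from M, two of the three terms in M on each side contain a zero
    projection, and the remaining pair is one axiom. *)
Lemma glue_assoc_ll x y m : glue_assoc (i0 x) (i0 y) (it m) ->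
  lcomp l x (l y m) = rcomp l (mul x y) m.
Proof.
case/map_in0_int_inj => _; rewrite !(prE n_gt1) !r0x => /addr3_eq[+ _ _].
apply; [exact: lcomp0l | exact: lcomp0r | exact: rcomp0r | exact: rcomp0r].
Qed.

Lemma glue_assoc_lr x y m : glue_assoc (i0 x) (it m) (i0 y) ->
  lcomp l x (r m y) = rcomp r (l x m) y.
Proof.
case/map_in0_int_inj => _; rewrite !(prE n_gt1) mul0x mulx0 lx0 r0x => /addr3_eq[_ + _].
apply; [exact: lcomp0l | exact: lcomp0r | exact: rcomp0l | exact: rcomp0l].
Qed.

Lemma glue_assoc_rr x y m : glue_assoc (it m) (i0 x) (i0 y) ->
  lcomp r m (mul x y) = rcomp r (r m x) y.
Proof.
case/map_in0_int_inj => _; rewrite !(prE n_gt1) mul0x !lx0 => /addr3_eq[_ _ +].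
apply; [exact: lcomp0l | exact: lcomp0l | exact: rcomp0l | exact: rcomp0l].
Qed.

Lemma pcomp_glue_eq0 N i (a : N.-tuple G) k m : (i < k)%N ->
    ~~ [|| (k == 2%N) && (m == 2%N), (k == 2%N) && (m == n.+1) | (k == n.+1) && (m == 2%N)] ->
  pcomp i (@g k) (@g m) a = 0.
Proof.
move=> ik km.
have [k2|k2] := boolP ((k == 2%N) || (k == n.+1)); last first.
  by apply: pcomp0l => b; apply: glue_0; lia.
have [m2|m2] := boolP ((m == 2%N) || (m == n.+1)); last first.
  by apply: pcomp0r => b; apply: glue_0; lia.
have [kn mn] : k = n.+1 /\ m = n.+1 by lia.
by subst k m; rewrite glue_n1 // pcomp_top_top.
Qed.

(** The inner arity [m] is a separate parameter, so that N + 1 - k can be rewritten to its value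
    although the types of the tuples depend on it. *)
Definition ainf_part N (d : N.-tuple int) (a : N.-tuple G) k m : pmod G N.-1 :=
  \sum_(i < k) pcomp i (@g k) (@g m) a *~
    (-1) ^ ((i.+1 * m.+1)%N%:Z + m%:Z * \sum_(j < i) d`_j).

Lemma ainf_part_eq0 N (d : N.-tuple int) (a : N.-tuple G) k m :
    ~~ [|| (k == 2%N) && (m == 2%N), (k == 2%N) && (m == n.+1) | (k == n.+1) && (m == 2%N)] ->
  ainf_part d a k m = 0.
Proof.
by move=> km; apply: big1 => i _; rewrite pcomp_glue_eq0 // mul0rz.
Qed.

Lemma ainf_sum3 (d : 3.-tuple int) (a : 3.-tuple G) :
  \sum_(1 <= k < 4) ainf_part d a k (4 - k) = pcomp 1 g2 g2 a - pcomp 0 g2 g2 a.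
Proof.
rewrite (bigD1_seq 2%N) //= big1_seq ?addr0 => [|k /andP[k2]]; last first.
  by rewrite mem_index_iota => kN; apply: (ainf_part_eq0 d a); lia.
rewrite /ainf_part (_ : (4 - 2)%N = 2%N) // glue_2 // !big_ord_recl big_ord0 addr0 /=.
rewrite !big_ord0 [RHS]addrC; congr (_ + _).
(* The exponent at slot 1 is 2 * 3 + 2 d_0 = 2 (3 + d_0), whereas at slot 0 it is 3. *)
by rewrite (@exprN1_addM2 _ 0 (3 + d`_0)); last by rewrite /bump; case: (tval d) => [|e s] /=; lia.
Qed.

Lemma ainf_sum_top (d : n.+2.-tuple int) (a : n.+2.-tuple G) :
    (forall j, in_degree (tnth d j) (tnth a j)) ->
  \sum_(1 <= k < n.+3) ainf_part d a k (n.+3 - k) =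
  map_pm it (delta mul l r (theta : _ -> pmod M n.+1.-1) (map_tuple p0 a)).
Proof.
move=> da.
rewrite (bigD1_seq 2%N) ?iota_uniq ?mem_index_iota //=.
rewrite big_mkcond (bigD1_seq n.+1) ?iota_uniq ?mem_index_iota /=; [|lia..].
rewrite big1_seq ?addr0 => [|k /andP[kn]]; last first.
  rewrite mem_index_iota => kN; case: ifP => // k2.
  by apply: (ainf_part_eq0 d a); lia.
rewrite ifT; last by lia.
rewrite (_ : n.+3 - n.+1 = 2)%N; last by lia.
rewrite (_ : n.+3 - 2 = n.+1)%N; last by lia.
rewrite {1}/ainf_part glue_2 // glue_n1 // !big_ord_recl big_ord0 addr0 /=.
rewrite /ainf_part glue_2 // glue_n1 // pcomp_2_top_first pcomp_2_top_last.
rewrite /delta plugL !raddfD /= raddf_sum raddfMz big_mkord -addrA addrC.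
congr (_ + _ + _).
(* The exponent is 2 (n + 2) + (n + 1) d_0. It is even for d_0 = 0; otherwise the first argument has
   no component of degree 0 and the term vanishes on both sides. *)
- have [d0|d0] := eqVneq d`_0 0.
    rewrite (@exprN1_addM2 _ 0 (n.+2)%:Z) ?mulr1z //.
    by rewrite d0 big_ord0 /bump /=; lia.
  have a0 : (map_tuple p0 a)`_0 = 0.
    have := da ord0; rewrite (tnth_nth 0) (tnth_nth 0) => -[y ay].
    by rewrite nth_map_tuple /= ay gr_pr_in.
  by rewrite !plug0l ?raddf0 ?mul0rz // a0.
- apply: eq_bigr => i _; rewrite pcomp_top_2 // raddfMz; congr (_ *~ _).
  (* With inner arity 2 the exponent is 3 (i + 1) plus twice a sum of degrees, which has the parity
     of the Hochschild sign i + 1. *)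
  rewrite (@exprN1_addM2 _ i.+1 (i.+1%:Z + \sum_(j < i) d`_j)) //.
  by move: (\sum_(j < i) _) => s; lia.
- by rewrite big_ord0 mulr0 addr0 mul1n exprnP.
Qed.

Lemma ainf_sum_other N (d : N.-tuple int) (a : N.-tuple G) : N != 3%N -> N != n.+2 ->
  \sum_(1 <= k < N.+1) ainf_part d a k (N.+1 - k) = 0.
Proof.
move=> N3 Nn; rewrite big_seq; apply: big1 => k.
by rewrite mem_index_iota => kN; apply: (ainf_part_eq0 d a); lia.
Qed.

End Glue.

(** * The two correspondences *)

Section Cohomologous.
Context (C : fieldType) (A M : lmodType {poly C}) (mul : A -> A -> pmod A 1).
Context (l : A -> M -> pmod M 1) (r : M -> A -> pmod M 1).
Hypotheses (sl : csesq2 l) (sr : csesq2 r).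
Local Notation delta := (delta mul l r).

Lemma deltaD k (phi psi : k.-tuple A -> pmod M k.-1) a :
  delta (fun b => phi b + psi b) a = delta phi a + delta psi a.
Proof.
rewrite /Defs.delta plugL plugDr; last exact: csesq2Dr.
rewrite plugDr; last exact: csesq2Dl.
rewrite mulrzDl [RHS]addrACA [X in _ = X + _]addrACA; congr (_ + _ + _).
rewrite -big_split /=.
apply: eq_bigr => i _.
rewrite -mulrzDl; exact: (congr1 (fun q : pmod M k => q *~ (-1) ^+ i.+1)
  (pcompDl phi (fun b : 2.-tuple A => mul b`_0 b`_1) psi i a)).
Qed.

Lemma delta0 k a : delta (fun _ : k.-tuple A => 0 : pmod M k.-1) a = 0.
Proof.
have := deltaD (fun=> 0) (fun=> 0) a.
rewrite (_ : (fun b => 0 + 0) = fun=> 0); last by apply/funext => b; exact: addr0.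
by move=> e; apply: (addrI (delta (fun=> 0) a)); rewrite addr0; exact: esym e.
Qed.

Lemma deltaN k (phi : k.-tuple A -> pmod M k.-1) a :
  delta (fun b => - phi b) a = - delta phi a.
Proof.
have := deltaD phi (fun b => - phi b) a.
rewrite (_ : (fun b => phi b - phi b) = fun=> 0); last first.
  by apply/funext => b; exact: subrr.
by rewrite delta0 => /esym/addr0_eq ->.
Qed.

Context (k : nat).
Local Notation cohomologous := (@cohomologous C A M mul l r k).

Lemma cohomologous_refl phi : cohomologous phi phi.
Proof. by exists (fun=> 0) => [|a]; [exact: csesq0 | rewrite delta0 addr0]. Qed.

Lemma cohomologous_sym phi psi : cohomologous phi psi -> cohomologous psi phi.
Proof.
case=> s ss e; exists (fun a => - s a); first exact: csesqN.
by move=> a; rewrite deltaN e addrK.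
Qed.

Lemma cohomologous_trans phi psi xi :
  cohomologous phi psi -> cohomologous psi xi -> cohomologous phi xi.
Proof.
case=> s ss e [s' ss' e']; exists (fun a => s a + s' a); first exact: csesqD.
by move=> a; rewrite deltaD e' e [RHS]addrA.
Qed.

End Cohomologous.

(** * Structures are determined by their underlying maps *)

Section Extensionality.
Context (C : fieldType) (n : nat).

(** The types of the bimodule and of the cocycle depend on the preceding structures, so the
    hypotheses compare bare maps, whose types do not. Once these are identified, the remaining
    fields are propositions and proof irrelevance applies. *)
Lemma triple_ext (A M : lmodType {poly C}) (T T' : triple n A M) :
  ac_mul (tr_alg T) = ac_mul (tr_alg T') -> cb_l (tr_bim T) = cb_l (tr_bim T') ->
  cb_r (tr_bim T) = cb_r (tr_bim T') ->
  tr_theta T = tr_theta T' :> (_ -> _) -> T = T'.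
Proof.
case: T T' => [[m sm am] [l r sl sr ll lr rr] [th sth dth]].
case=> [[m' sm' am'] [l' r' sl' sr' ll' lr' rr'] [th' sth' dth']] /=.
move=> em el er et; subst m' l' r' th'.
move: (Prop_irrelevance sm sm') (Prop_irrelevance am am') => ? ?; subst sm' am'.
move: (Prop_irrelevance sl sl') (Prop_irrelevance sr sr') => ? ?; subst sl' sr'.
move: (Prop_irrelevance ll ll') (Prop_irrelevance lr lr') => ? ?; subst ll' lr'.
move: (Prop_irrelevance rr rr') => ?; subst rr'.
by move: (Prop_irrelevance sth sth') (Prop_irrelevance dth dth') => -> ->.
Qed.

Lemma triple_class_ext (A M : lmodType {poly C}) (T T' : triple_class n A M) :
  ac_mul (tc_alg T) = ac_mul (tc_alg T') -> cb_l (tc_bim T) = cb_l (tc_bim T') ->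
  cb_r (tc_bim T) = cb_r (tc_bim T') ->
  sval (tc_theta T) = sval (tc_theta T') -> T = T'.
Proof.
case: T T' => [[m sm am] [l r sl sr ll lr rr] [th zth]].
case=> [[m' sm' am'] [l' r' sl' sr' ll' lr' rr'] [th' zth']] /=.
move=> em el er et; subst m' l' r' th'.
move: (Prop_irrelevance sm sm') (Prop_irrelevance am am') => ? ?; subst sm' am'.
move: (Prop_irrelevance sl sl') (Prop_irrelevance sr sr') => ? ?; subst sl' sr'.
move: (Prop_irrelevance ll ll') (Prop_irrelevance lr lr') => ? ?; subst ll' lr'.
move: (Prop_irrelevance rr rr') => ?; subst rr'.
by move: (Prop_irrelevance zth zth') => ->.
Qed.

Lemma skeletal_ext (G : graded_module C) (S S' : skeletal n G) :
  (forall k a, S k a = S' k a) -> S = S'.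
Proof.
move=> SS'; have {SS'} : (S : forall k, _) = (S' : forall k, _).
  by apply: functional_extensionality_dep => k; apply/funext.
case: S S' => [[mu m0 ms md ma] su m1] [[mu' m0' ms' md' ma'] su' m1'] /= e.
subst mu'.
move: (Prop_irrelevance m0 m0') (Prop_irrelevance ms ms') => ? ?; subst m0' ms'.
move: (Prop_irrelevance md md') (Prop_irrelevance ma ma') => ? ?; subst md' ma'.
by move: (Prop_irrelevance su su') (Prop_irrelevance m1 m1') => -> ->.
Qed.

End Extensionality.

(** * The bijections over a fixed graded module, for structures and for classes *)

Section Correspondence.
Context (C : fieldType) (n : nat) (n_gt1 : (1 < n)%N).
Context (G : graded_module C) (supp : skeletal_support n G).
Local Notation t := (n.-1%:Z).
Local Notation A := (gr G 0).
Local Notation M := (gr G n.-1%:Z).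
Local Notation i0 := (gr_in G 0).
Local Notation it := (gr_in G n.-1%:Z).
Local Notation p0 := (gr_pr G 0).
Local Notation pt := (gr_pr G n.-1%:Z).

Lemma in_degree0 d : in_degree d (0 : G).
Proof. by exists 0; rewrite raddf0. Qed.

Section ToTriple.
Context (S : skeletal n G).

Let sm : csesq2 (sk_mul S) := csesq2_mu2_at S 0 0 0.
Let sl : csesq2 (sk_l S) := csesq2_mu2_at S 0 t t.
Let sr : csesq2 (sk_r S) := csesq2_mu2_at S t 0 t.
Let st := csesq_sk_top S.

Lemma sk_ainf_sum N (d : N.-tuple int) (a : N.-tuple G) : (0 < N)%N ->
    (forall j, in_degree (tnth d j) (tnth a j)) ->
  \sum_(1 <= k < N.+1)
    ainf_part (sk_mul S) (sk_l S) (sk_r S) (sk_top S) d a k (N.+1 - k) = 0.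
Proof.
move=> N0 da; apply: etrans (mu_ainf S N0 da).
have Sg k : S k = @glue _ _ _ (sk_mul S) (sk_l S) (sk_r S) (sk_top S) k.
  by apply/funext => b; exact: skeletal_glue.
by apply: eq_bigr => k _; rewrite /ainf_part; apply: eq_bigr => i _; rewrite !Sg.
Qed.

Lemma sk_glue_assoc (dx dy dz : int) (x y z : G) :
    in_degree dx x -> in_degree dy y -> in_degree dz z ->
  glue_assoc (sk_mul S) (sk_l S) (sk_r S) x y z.
Proof.
move=> hx hy hz; apply/(glue_assocP n_gt1 sm sl sr).
apply/eqP; rewrite -subr_eq0; apply/eqP.
rewrite -(ainf_sum3 n_gt1 _ _ _ st [tuple dx; dy; dz]) sk_ainf_sum //.
by move=> -[[|[|[|]]]].
Qed.

Lemma in_degree_in d (x : gr G d) : in_degree d (gr_in G d x).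
Proof. by exists x. Qed.

Lemma sk_assoc x y z :
  lcomp (sk_mul S) x (sk_mul S y z) = rcomp (sk_mul S) (sk_mul S x y) z.
Proof.
apply: (glue_assoc_mul (l := sk_l S) (r := sk_r S) n_gt1).
exact: sk_glue_assoc (in_degree_in _) (in_degree_in _) (in_degree_in _).
Qed.

Lemma sk_ll x y m :
  lcomp (sk_l S) x (sk_l S y m) = rcomp (sk_l S) (sk_mul S x y) m.
Proof.
apply: (glue_assoc_ll n_gt1 sr).
exact: sk_glue_assoc (in_degree_in _) (in_degree_in _) (in_degree_in _).
Qed.

Lemma sk_lr x m y :
  lcomp (sk_l S) x (sk_r S m y) = rcomp (sk_r S) (sk_l S x m) y.
Proof.
apply: (glue_assoc_lr n_gt1 sm sl sr).
exact: sk_glue_assoc (in_degree_in _) (in_degree_in _) (in_degree_in _).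
Qed.

Lemma sk_rr m x y :
  lcomp (sk_r S) m (sk_mul S x y) = rcomp (sk_r S) (sk_r S m x) y.
Proof.
apply: (glue_assoc_rr n_gt1 sm sl).
exact: sk_glue_assoc (in_degree_in _) (in_degree_in _) (in_degree_in _).
Qed.

(** The identity N = n + 2, evaluated on elements of degree 0 and projected to M. *)
Lemma sk_cocycle b :
  delta (sk_mul S) (sk_l S) (sk_r S) (sk_top S : _ -> pmod _ n.+1.-1) b = 0.
Proof.
pose d := [tuple 0%:Z | _ < n.+2].
have da j : in_degree (tnth d j) (tnth (map_tuple i0 b) j).
  by rewrite tnth_mktuple tnth_map; exact: in_degree_in.
have := sk_ainf_sum (ltn0Sn _) da; rewrite (ainf_sum_top n_gt1 sm sl sr st da).
move/(congr1 (map_pm pt)); rewrite map_prt_int raddf0 => <-.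
by congr delta; apply: eq_from_tnth => j; rewrite !tnth_map pr0_in0.
Qed.

Definition skeletal_alg : assoc_conformal A := AssocConformal sm sk_assoc.

Definition skeletal_bim : conformal_bimodule skeletal_alg M :=
  @ConformalBimodule _ _ skeletal_alg _ _ _ sl sr sk_ll sk_lr sk_rr.

Definition triple_of_skeletal : triple n A M :=
  Triple (@Cocycle _ _ _ _ skeletal_bim n.+1 (sk_top S) st sk_cocycle).

End ToTriple.

Section OfTriple.
Context (T : triple n A M).
Local Notation mul := (ac_mul (tr_alg T)).
Local Notation l := (cb_l (tr_bim T)).
Local Notation r := (cb_r (tr_bim T)).
Local Notation theta := (cocycle_val (tr_theta T)).

Let sm : csesq2 mul := ac_sesq _.
Let sl : csesq2 l := cb_l_sesq _.
Let sr : csesq2 r := cb_r_sesq _.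
Let st : csesq theta := cocycle_sesq (tr_theta T).

Local Notation g := (glue mul l r (theta : n.+1.-tuple A -> pmod M n)).

Lemma glue_triple_mu0 a : @g 0 a = 0.
Proof. exact: glue_0. Qed.

Lemma pr_in_degree d x : in_degree d x -> forall e, d != e -> gr_pr G e x = 0.
Proof. by case=> y -> e; exact: gr_pr_in. Qed.

(** Zero has every degree, so nothing is to be checked when a degree lies outside the support or
    when both equal n - 1: all three terms vanish there. *)
Lemma glue2_degree dx dy (x y : G) m :
    in_degree dx x -> in_degree dy y ->
  in_degree (dx + dy) ((glue2 mul l r [tuple x; y])@_m).
Proof.
move=> /pr_in_degree hx /pr_in_degree hy; rewrite /glue2 /= monalg.mcoeffD.
have [mul0 mulx0] : (forall u, mul 0 u = 0) /\ (forall u, mul u 0 = 0).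
  by split=> u; [exact: morphD0 (csesq2Dl _ sm) | exact: morphD0 (csesq2Dr _ sm)].
have [l0 lx0] : (forall u, l 0 u = 0) /\ (forall u, l u 0 = 0).
  by split=> u; [exact: morphD0 (csesq2Dl _ sl) | exact: morphD0 (csesq2Dr _ sl)].
have [r0 rx0] : (forall u, r 0 u = 0) /\ (forall u, r u 0 = 0).
  by split=> u; [exact: morphD0 (csesq2Dl _ sr) | exact: morphD0 (csesq2Dr _ sr)].
have [dx0|/hx px0] := eqVneq dx 0.
  rewrite (hx t) ?dx0; last by rewrite eq_sym top_neq0.
  rewrite r0 addr0 add0r; have [dy0|/hy py0] := eqVneq dy 0.
    rewrite (hy t) ?dy0; last by rewrite eq_sym top_neq0.
    by rewrite lx0 raddf0 monalg.mcoeff0 addr0 map_pmE ?raddf0 //; exact: in_degree_in.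
  rewrite py0 mulx0 raddf0 monalg.mcoeff0 add0r.
  have [->|/hy pty] := eqVneq dy t; first by rewrite map_pmE ?raddf0 //; exact: in_degree_in.
  by rewrite pty lx0 raddf0 monalg.mcoeff0; exact: in_degree0.
rewrite px0 mul0 l0 raddf0 monalg.mcoeff0 !add0r.
have [->|/hx ptx] := eqVneq dx t; last first.
  by rewrite ptx r0 raddf0 monalg.mcoeff0; exact: in_degree0.
have [->|/hy py0] := eqVneq dy 0.
  by rewrite addr0 map_pmE ?raddf0 //; exact: in_degree_in.
by rewrite py0 rx0 raddf0 monalg.mcoeff0; exact: in_degree0.
Qed.

Lemma glue_triple_degree k (d : k.-tuple int) (a : k.-tuple G) : (0 < k)%N ->
    (forall j, in_degree (tnth d j) (tnth a j)) ->
  forall m, in_degree (\sum_(j < k) tnth d j + k%:Z - 2) ((g a)@_m).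
Proof.
move=> k0 da m.
have [k2|k2] := eqVneq k 2%N.
  subst k; rewrite glue_2 // !big_ord_recl big_ord0 addr0 addrK.
  have -> : a = [tuple tnth a ord0; tnth a (lift ord0 ord0)].
    by apply: eq_from_tnth => -[[|[|]]] // i; congr tnth; exact: val_inj.
  exact: glue2_degree.
have [kn|kn] := eqVneq k n.+1; last first.
  by rewrite glue_0 // monalg.mcoeff0; exact: in_degree0.
subst k; rewrite glue_n1 //.
have [[j dj]|d0] := pselect (exists j, tnth d j != 0).
  rewrite /glue_top (csesq_eq0 (i := j) st) ?raddf0 ?monalg.mcoeff0.
    exact: in_degree0.
  by rewrite tnth_map; exact: (pr_in_degree (da j)).
rewrite big1 => [|j _]; last by apply: contra_notP d0 => /eqP; exists j.
rewrite /glue_top map_pmE ?raddf0 // (_ : 0 + n.+1%:Z - 2 = t); last by lia.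
exact: in_degree_in.
Qed.

Lemma glue_triple_assoc (x y z : G) : glue_assoc mul l r x y z.
Proof.
apply: (f_equal2 (fun u v => map_pm i0 u + map_pm it v)); first exact: ac_assoc.
by apply: addr3_rot; [exact: cb_rr | exact: cb_ll | exact: cb_lr].
Qed.

Lemma glue_triple_ainf N (d : N.-tuple int) (a : N.-tuple G) : (0 < N)%N ->
    (forall j, in_degree (tnth d j) (tnth a j)) ->
  \sum_(1 <= k < N.+1) ainf_part mul l r theta d a k (N.+1 - k) = 0.
Proof.
move=> N0 da; have [N3|N3] := eqVneq N 3%N.
  subst N; rewrite (ainf_sum3 n_gt1 _ _ _ st); apply/eqP; rewrite subr_eq0; apply/eqP.
  have -> : a = [tuple tnth a ord0; tnth a (lift ord0 ord0); tnth a ord_max].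
    by apply: eq_from_tnth => -[[|[|[|]]]] // i; congr tnth; exact: val_inj.
  by apply/(glue_assocP n_gt1 sm sl sr); exact: glue_triple_assoc.
have [Nn|Nn] := eqVneq N n.+2; last exact: ainf_sum_other.
subst N; rewrite (ainf_sum_top n_gt1 sm sl sr st da).
by rewrite (cocycle_eq0 (tr_theta T)) raddf0.
Qed.

Lemma glue_triple_mu1 a : @g 1 a = 0.
Proof. by apply: glue_0 => //; lia. Qed.

Definition skeletal_of_triple : skeletal n G :=
  @Skeletal _ n G
    (@AinfConformal _ G (fun k => @g k) glue_triple_mu0
      (fun k _ => csesq_glue sm sl sr st k) glue_triple_degree glue_triple_ainf)
    supp glue_triple_mu1.

Lemma skeletal_of_tripleK : triple_of_skeletal skeletal_of_triple = T.
Proof.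
apply: triple_ext => /=.
- apply/funext => x; apply/funext => y.
  by rewrite /sk_mul /mu2_at pmod_mapL /= glue_2 // map_pr0_glue2 //= !pr0_in0.
- apply/funext => x; apply/funext => y.
  rewrite /sk_l /mu2_at pmod_mapL /= glue_2 // map_prt_glue2 //=.
  rewrite pr0_in0 prt_int prt_in0 //.
  by rewrite (morphD0 (csesq2Dl _ sr)) addr0.
- apply/funext => x; apply/funext => y.
  rewrite /sk_r /mu2_at pmod_mapL /= glue_2 // map_prt_glue2 //=.
  rewrite pr0_in0 prt_int pr0_int //.
  by rewrite (morphD0 (csesq2Dl _ sl)) add0r.
- apply/funext => x.
  rewrite /sk_top pmod_mapL /= glue_n1 // map_prt_int.
  by congr theta; apply: eq_from_tnth => j; rewrite !tnth_map pr0_in0.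
Qed.

End OfTriple.

Lemma triple_of_skeletalK (S : skeletal n G) :
  skeletal_of_triple (triple_of_skeletal S) = S.
Proof. by apply: skeletal_ext => k a; rewrite [RHS]skeletal_glue. Qed.

(** Exhibits equivalence as the kernel of the map to tuples with a cohomology class. It is therefore
    an equivalence relation, and the induced map on classes is well defined and injective. *)
Lemma sk_equivP (S S' : skeletal n G) :
  sk_equiv S S' <-> class_of_triple (triple_of_skeletal S) =
                    class_of_triple (triple_of_skeletal S').
Proof.
have sl := csesq2_mu2_at S 0 t t; have sr := csesq2_mu2_at S t 0 t.
split=> [[mu2 coh]|e].
  have em : sk_mul S = sk_mul S'.
    by apply/funext => x; apply/funext => y; rewrite /sk_mul /mu2_at mu2.
  have el : sk_l S = sk_l S'.
    by apply/funext => x; apply/funext => y; rewrite /sk_l /mu2_at mu2.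
  have er : sk_r S = sk_r S'.
    by apply/funext => x; apply/funext => y; rewrite /sk_r /mu2_at mu2.
  (* Cosets are predicates on cochains: symmetry and transitivity make them equivalent pointwise,
     and extensionality makes them equal. *)
  have ec : cohomologous (sk_mul S) (sk_l S) (sk_r S) (sk_top S) =
      cohomologous (sk_mul S') (sk_l S') (sk_r S') (sk_top S').
    rewrite -em -el -er; apply/funext => psi; apply/propext; split=> h.
      exact: (cohomologous_trans sl sr (cohomologous_sym sl sr coh) h).
    exact: (cohomologous_trans sl sr coh h).
  by apply: triple_class_ext; [exact: em | exact: el | exact: er | exact: ec].
have em : sk_mul S = sk_mul S' := congr1 (fun c => ac_mul (tc_alg c)) e.
have el : sk_l S = sk_l S' := congr1 (fun c => cb_l (tc_bim c)) e.
have er : sk_r S = sk_r S' := congr1 (fun c => cb_r (tc_bim c)) e.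
split=> [a|].
  apply: etrans (skeletal_mu2 n_gt1 supp S a) _.
  by apply: etrans (esym (skeletal_mu2 n_gt1 supp S' a)); rewrite em el er.
(* As a predicate on cochains the coset has a type independent of the algebra and the bimodule, so
   it can be read off from the equality of tuples; reflexivity is then transported along it. *)
have ec : cohomologous (sk_mul S) (sk_l S) (sk_r S) (sk_top S) =
    cohomologous (sk_mul S') (sk_l S') (sk_r S') (sk_top S') :=
  congr1 (fun c => sval (tc_theta c)) e.
have refl : cohomologous (sk_mul S') (sk_l S') (sk_r S') (sk_top S') (sk_top S').
  by apply: cohomologous_refl; exact: csesq2_mu2_at.
exact: (eq_ind_r (fun P => P (sk_top S')) refl ec).
Qed.

Lemma class_of_tripleP (c : triple_class n A M) : exists T, class_of_triple T = c.
Proof.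
case: c => alg bim [X XP]; have [z Xz] := XP; exists (Triple z).
by congr TripleClass; apply: eq_exist; rewrite Xz.
Qed.

Lemma eq_class_of_skeletal (S S' : skeletal n G) :
  class_of_skeletal S = class_of_skeletal S' <-> sk_equiv S S'.
Proof.
split=> [/(congr1 sval)/= e|/sk_equivP e].
  by rewrite e; apply/sk_equivP.
apply: eq_exist; apply/funext => S''; apply/propext.
split=> /sk_equivP h; apply/sk_equivP.
exact (etrans (esym e) h).
exact (etrans e h).
Qed.

(** A class carries only the existence of a representative, so one is chosen;
    [triple_class_of_skeletalE] shows that the induced map does not depend on the choice. *)
Definition class_rep (X : skeletal_class n G) : skeletal n G :=
  projT1 (cid (proj2_sig X)).

Lemma class_repK X : class_of_skeletal (class_rep X) = X.
Proof.
rewrite /class_rep; case: cid => S /= e.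
by case: X e => X hX /= e; apply: eq_exist.
Qed.

Definition triple_class_of_skeletal (X : skeletal_class n G) : triple_class n A M :=
  class_of_triple (triple_of_skeletal (class_rep X)).

Lemma triple_class_of_skeletalE S :
  triple_class_of_skeletal (class_of_skeletal S) =
  class_of_triple (triple_of_skeletal S).
Proof. by apply/sk_equivP/eq_class_of_skeletal; exact: class_repK. Qed.

Lemma triple_class_of_skeletal_bij : bijective triple_class_of_skeletal.
Proof.
exists (fun c => class_of_skeletal (skeletal_of_triple (projT1 (cid (class_of_tripleP c))))).
  move=> X; case: cid => T /= e; rewrite -[RHS]class_repK.
  by apply/eq_class_of_skeletal/sk_equivP; rewrite skeletal_of_tripleK.
move=> c; case: cid => T /= e.
by rewrite triple_class_of_skeletalE skeletal_of_tripleK.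
Qed.

End Correspondence.

(** * A graded module with prescribed components in degrees 0 and n - 1 *)

Section TwoTerm.
Context (C : fieldType) (n : nat) (n_gt1 : (1 < n)%N) (A M : lmodType {poly C}).

Definition inl_mod (x : A) : A * M := (x, 0).
Definition inr_mod (y : M) : A * M := (0, y).

Lemma inl_mod_linear : linear inl_mod.
Proof. by move=> c x y; congr pair; rewrite /= scaler0 addr0. Qed.

Lemma inr_mod_linear : linear inr_mod.
Proof. by move=> c x y; congr pair; rewrite /= scaler0 addr0. Qed.

HB.instance Definition _ :=
  GRing.isLinear.Build {poly C} A (A * M)%type _ inl_mod inl_mod_linear.
HB.instance Definition _ :=
  GRing.isLinear.Build {poly C} M (A * M)%type _ inr_mod inr_mod_linear.

(* [Some true] stands for degree 0, [Some false] for degree n - 1 and [None]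
   for all the other degrees. *)
Definition slot (d : int) : option bool :=
  if d == 0 then Some true else if d == n.-1%:Z then Some false else None.

(** Dispatching on the slot makes the component of degree 0 compute to [A], and that of degree n - 1
    become [M] by rewriting with [slot_top]: equalities of modules, not mere isomorphisms. *)
Definition slot_mod (s : option bool) : lmodType {poly C} :=
  match s with Some true => A | Some false => M | None => 'rV[{poly C}]_0 end.

Definition slot_in s : {linear slot_mod s -> (A * M)%type} :=
  match s with
  | Some true => inl_mod : {linear A -> (A * M)%type}
  | Some false => inr_mod : {linear M -> (A * M)%type}
  | None => \0 : {linear 'rV[{poly C}]_0 -> (A * M)%type}
  end.

Definition slot_pr s : {linear (A * M)%type -> slot_mod s} :=
  match s with
  | Some true => fst : {linear (A * M)%type -> A}
  | Some false => snd : {linear (A * M)%type -> M}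
  | None => \0 : {linear (A * M)%type -> 'rV[{poly C}]_0}
  end.

Lemma slot_inK s : cancel (slot_in s) (slot_pr s).
Proof. by case: s => [[]|] x //; apply/rowP => -[]. Qed.

Lemma slot_top : slot n.-1%:Z = Some false.
Proof. by rewrite /slot eqxx ifF //; apply/negbTE; lia. Qed.

(** Distinct degrees may share the slot [None], whose module is zero; the second alternative covers
    them. *)
Lemma slot_pr_in_neq s s' x :
  (s != s') || (s == None) -> slot_pr s' (slot_in s x) = 0.
Proof. by case: s s' x => [[]|] [[]|]. Qed.

Lemma slot_pr_in d e x : d != e -> slot_pr (slot e) (slot_in (slot d) x) = 0.
Proof.
move=> de; apply: slot_pr_in_neq; rewrite /slot.
have [d0|d0] := eqVneq d 0; first by rewrite -d0 [e == d]eq_sym (negbTE de); case: ifP.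
have [dn|dn] := eqVneq d n.-1%:Z; last by rewrite orbT.
by rewrite -dn [e == d]eq_sym (negbTE de); case: ifP.
Qed.

Lemma slot_sum (x : A * M) : exists2 s : seq int,
  uniq s & x = \sum_(d <- s) slot_in (slot d) (slot_pr (slot d) x).
Proof.
exists [:: 0; n.-1%:Z]; first by rewrite /= inE andbT; lia.
rewrite big_cons big_seq1 slot_top /slot /=.
by case: x => x y; congr pair; rewrite /= ?addr0 ?add0r.
Qed.

Definition two_slot_module : graded_module C :=
  @GradedModule C (A * M)%type (fun d => slot_mod (slot d))
    (fun d => slot_in (slot d)) (fun d => slot_pr (slot d))
    (fun d => @slot_inK (slot d)) slot_pr_in slot_sum.

Lemma two_slot_support : skeletal_support n two_slot_module.
Proof.
have triv d : d != 0 -> d != n.-1%:Z -> forall x : gr two_slot_module d, x = 0.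
  move=> d0 dn /=; rewrite /slot (negbTE d0) (negbTE dn) => x.
  by apply/rowP => -[].
by split=> // d dN; apply: triv; apply: contraNneq dN => ->; lia.
Qed.

End TwoTerm.

Theorem theorem4p4 (R : realType) (n : nat) (hn : (2 <= n)%N) :
  (forall A M : lmodType {poly R[i]},
     exists G : graded_module R[i],
       [/\ skeletal_support n G, gr G 0 = A & gr G n.-1%:Z = M])
  /\
  (forall G : graded_module R[i], skeletal_support n G ->
     exists (Phi : skeletal n G -> triple n (gr G 0) (gr G n.-1%:Z))
            (Phibar : skeletal_class n G ->
                      triple_class n (gr G 0) (gr G n.-1%:Z)),
       [/\ forall S : skeletal n G,
             [/\ ac_mul (tr_alg (Phi S)) = sk_mul S,
                 cb_l (tr_bim (Phi S)) = sk_l S,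
                 cb_r (tr_bim (Phi S)) = sk_r S
               & tr_theta (Phi S) = sk_top S :> (_ -> _)],
           bijective Phi,
           forall S : skeletal n G,
             Phibar (class_of_skeletal S) = class_of_triple (Phi S)
         & bijective Phibar]).
Proof.
split=> [A M|G supp]; last first.
  exists (triple_of_skeletal hn supp), (triple_class_of_skeletal hn supp); split.
  - by move=> S; split.
  - exists (skeletal_of_triple hn supp).
      exact: triple_of_skeletalK.
    exact: skeletal_of_tripleK.
  - exact: triple_class_of_skeletalE.
  - exact: triple_class_of_skeletal_bij.
exists (two_slot_module hn A M); split=> //; first exact: two_slot_support.
by rewrite /= slot_top.
Qed.
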